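(* Let $\boldsymbol{k}$ be a non-empty index and $\boldsymbol{z}\in\mathbb{D}^{\mathrm{dep}(\boldsymbol{k})}$ such that the pair $\left({\boldsymbol{z}\atop\boldsymbol{k}}\right)$ satisfies the dual condition, write $\left({\boldsymbol{z}\atop\boldsymbol{k}}\right)^\dagger=\left({\boldsymbol{z}'\atop\boldsymbol{k}'}\right)$ and set $d=\iota(\boldsymbol{z})$. Then for every non-negative integer $h$, \[ O_h\left({\boldsymbol{z}\atop\boldsymbol{k}}\right)=(-1)^{d}\sum_{i=0}^h\sum_{\substack{b_1,\dots,b_d\ge0\\ b_1+\cdots+b_d=i}}O_{h-i}\left(\left({\boldsymbol{z}'\atop\boldsymbol{k}'}\right)_{b_1,\dots,b_d}\right). \] In particular, if $d=0$ (so $\boldsymbol{k}$ is admissible), then $O_h\left({\{1\}^{\mathrm{dep}(\boldsymbol{k})}\atop\boldsymbol{k}}\right)=O_h\left({\{1\}^{\mathrm{dep}(\boldsymbol{k}^\dagger)}\atop\boldsymbol{k}^\dagger}\right)$.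
   Context: $\mathbb{D}=\{z\in\mathbb{C}:|z|\le1\}$; $\{a\}^m$ denotes $m$ repetitions of $a$. An index is a finite tuple of positive integers (possibly empty); it is admissible if empty or its last entry is $\ge2$. Pairs $\left({\boldsymbol{z}\atop\boldsymbol{k}}\right)$ (a tuple of variables over an index of the same depth) are concatenated columnwise. $\mathrm{Li}^{\mathrm{sh}}_{\boldsymbol{k}}(z_1,\dots,z_r)=\sum_{0=m_0<m_1<\cdots<m_r}\prod_i z_i^{m_i-m_{i-1}}m_i^{-k_i}$. Dual index: a non-empty admissible index is uniquely $\boldsymbol{k}=(\{1\}^{a_1-1},b_1+1,\dots,\{1\}^{a_h-1},b_h+1)$ with $a_i,b_i\ge1$, and $\boldsymbol{k}^\dagger=(\{1\}^{b_h-1},a_h+1,\dots,\{1\}^{b_1-1},a_1+1)$; $\varnothing^\dagger=\varnothing$. $\iota(\boldsymbol{z})$ is the number of entries of $\boldsymbol{z}$ different from $1$. Dual condition for $\boldsymbol{k}=(k_1,\dots,k_r)$, $\boldsymbol{z}=(z_1,\dots,z_r)\in\mathbb{D}^r$: each $z_i\in\{z\in\mathbb{D}\setminus\{0\}:\mathrm{Re}(z)\le\frac12\}\cup\{1\}$, $\mathrm{Re}(z_1)\ne\frac12$, and if $\boldsymbol{k}$ is non-admissible then $|z_r|\ne1$. Such a pair is uniquely written as $\left({\{1\}^{r_1},\{1\}^{a_1-1},w_1,\dots,\{1\}^{r_d},\{1\}^{a_d-1},w_d,\{1\}^{r_{d+1}}\atop \boldsymbol{l}_1,\{1\}^{a_1-1},b_1,\dots,\boldsymbol{l}_d,\{1\}^{a_d-1},b_d,\boldsymbol{l}_{d+1}}\right)$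 with $d\ge0$, $a_i,b_i\ge1$, $w_i\ne1$, $\boldsymbol{l}_i$ admissible indices, $r_i=\mathrm{dep}(\boldsymbol{l}_i)$; then $\left({\boldsymbol{z}\atop\boldsymbol{k}}\right)^\dagger=\left({\{1\}^{s_{d+1}},\{1\}^{b_d-1},\frac{w_d}{w_d-1},\{1\}^{s_d},\dots,\{1\}^{b_1-1},\frac{w_1}{w_1-1},\{1\}^{s_1}\atop \boldsymbol{l}_{d+1}^\dagger,\{1\}^{b_d-1},a_d,\boldsymbol{l}_d^\dagger,\dots,\{1\}^{b_1-1},a_1,\boldsymbol{l}_1^\dagger}\right)$ with $s_i=\mathrm{dep}(\boldsymbol{l}_i^\dagger)$. For $\boldsymbol{k}=(k_1,\dots,k_r)$, $\boldsymbol{z}\in\mathbb{D}^r$ with $|z_r|\ne1$ whenever $k_r=1$, and $h\ge0$: $O_h\left({\boldsymbol{z}\atop\boldsymbol{k}}\right)=\sum_{c_1+\cdots+c_r=h,\ c_i\ge0}\mathrm{Li}^{\mathrm{sh}}_{k_1+c_1,\dots,k_r+c_r}(\boldsymbol{z})$. For a non-empty pair with $d'=\iota(\boldsymbol{z})$, written as $\left({\{1\}^{a_1},z_1,\dots,\{1\}^{a_{d'}},z_{d'},\{1\}^{a_{d'+1}}\atop \boldsymbol{k}_1,l_1,\dots,\boldsymbol{k}_{d'},l_{d'},\boldsymbol{k}_{d'+1}}\right)$ with $z_i\ne1$, $\boldsymbol{k}_i$ indices of depth $a_i\ge0$, $l_i\ge1$, and for $b_1,\dots,b_{d'}\ge0$: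 $\left({\boldsymbol{z}\atop\boldsymbol{k}}\right)_{b_1,\dots,b_{d'}}=\left({\{1\}^{a_1},\{z_1\}^{b_1+1},\dots,\{1\}^{a_{d'}},\{z_{d'}\}^{b_{d'}+1},\{1\}^{a_{d'+1}}\atop \boldsymbol{k}_1,\{1\}^{b_1},l_1,\dots,\boldsymbol{k}_{d'},\{1\}^{b_{d'}},l_{d'},\boldsymbol{k}_{d'+1}}\right)$. *)

(* Defs.v *)
From HB Require Import structures.
From mathcomp Require Import all_boot all_order all_algebra.
From mathcomp Require Import complex.
From mathcomp Require Import all_classical all_reals all_analysis.

Set Implicit Arguments.
Unset Strict Implicit.
Unset Printing Implicit Defensive.

Import Order.TTheory GRing.Theory Num.Theory.
Import numFieldNormedType.Exports.

Local Open Scope ring_scope.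
Local Open Scope classical_set_scope.

(* A pair (z over k) of the same depth is a sequence of columns
   (z_i, k_i) : K * nat, so that concatenation of pairs is [++]. *)

Definition is_index (k : seq nat) : bool := all (leq 1) k.

Definition admissible (k : seq nat) : bool := (2 <= last 2 k)%N.

(* [:: (a_1, b_1); ...; (a_h, b_h)] stands for the index
   ({1}^(a_1 - 1), b_1 + 1, ..., {1}^(a_h - 1), b_h + 1). *)
Definition index_of_blocks (ab : seq (nat * nat)) : seq nat :=
  flatten [seq rcons (nseq x.1.-1 1%N) x.2.+1 | x <- ab].

Definition wf_index_blocks (ab : seq (nat * nat)) : bool :=
  all (fun x => (1 <= x.1)%N && (1 <= x.2)%N) ab.

(* [a.-1] is the number of entries 1 read since the last entry >= 2. *)
Fixpoint index_blocks_from (a : nat) (k : seq nat) : seq (nat * nat) :=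
  if k is x :: k' then
    if x == 1%N then index_blocks_from a.+1 k'
    else (a, x.-1) :: index_blocks_from 1 k'
  else [::].

Definition index_blocks (k : seq nat) : seq (nat * nat) :=
  index_blocks_from 1 k.

Definition dual_index (k : seq nat) : seq nat :=
  index_of_blocks [seq (x.2, x.1) | x <- rev (index_blocks k)].

Section Pairs.
Variable K : numFieldType.
Implicit Type p : seq (K * nat).

(* Truncation m_r <= N of the series over 0 = m_0 < m_1 < ... < m_r; the
   (0-based) i-th entry of 0 :: m is the predecessor of the i-th entry of m. *)
Definition Lish_trunc p (N : nat) : K :=
  \sum_(m : (size p).-tuple 'I_N.+1 | path ltn 0%N [seq val j | j <- m])
    \prod_(i < size p)
      ((nth (0, 0%N) p i).1
         ^+ (val (tnth m i) - nth 0%N (0%N :: [seq val j | j <- m]) i)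
       / (val (tnth m i))%:R ^+ (nth (0, 0%N) p i).2).

Definition Lish p : K := limn (Lish_trunc p).

Definition add_exponents p (c : seq nat) : seq (K * nat) :=
  [seq (x.1.1, (x.1.2 + x.2)%N) | x <- zip p c].

Definition Osum (h : nat) p : K :=
  \sum_(c : (size p).-tuple 'I_h.+1
          | (\sum_(i < size p) val (tnth c i))%N == h)
    Lish (add_exponents p [seq val j | j <- c]).

Definition num_ne1 (z : seq K) : nat := count (fun x => x != 1) z.

Definition ones (k : seq nat) : seq (K * nat) := [seq (1, x) | x <- k].

(* The block ({1}^r, {1}^(a - 1), w over l, {1}^(a - 1), b), r = dep l. *)
Record block := Block {
  block_l : seq nat; block_a : nat; block_w : K; block_b : nat }.

Definition wf_block (B : block) : bool :=
  [&& is_index (block_l B), admissible (block_l B), (1 <= block_a B)%N,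
      (1 <= block_b B)%N & block_w B != 1].

Definition block_cols (B : block) : seq (K * nat) :=
  ones (block_l B) ++ ones (nseq (block_a B).-1 1%N)
    ++ [:: (block_w B, block_b B)].

Definition dual_block_cols (B : block) : seq (K * nat) :=
  ones (nseq (block_b B).-1 1%N)
    ++ (block_w B / (block_w B - 1), block_a B) :: ones (dual_index (block_l B)).

(* A decomposition: d blocks together with the final index l_(d+1). *)
Definition wf_decomp (D : seq block * seq nat) : bool :=
  [&& all wf_block D.1, is_index D.2 & admissible D.2].

Definition assemble (D : seq block * seq nat) : seq (K * nat) :=
  flatten [seq block_cols B | B <- D.1] ++ ones D.2.

Definition dual_assemble (D : seq block * seq nat) : seq (K * nat) :=
  ones (dual_index D.2) ++ flatten [seq dual_block_cols B | B <- rev D.1].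

Definition trailing_ones (s : seq nat) : nat := find (predC1 1%N) (rev s).

Definition strip_ones (s : seq nat) : seq nat :=
  take (size s - trailing_ones s) s.

(* [s] accumulates the exponents of the columns with z = 1 read since the last
   column with z <> 1; when the next such column is met, s is split as
   l ++ {1}^(a - 1) with l admissible. *)
Fixpoint decompose_from (s : seq nat) p : seq block * seq nat :=
  if p is (w, b) :: p' then
    if w == 1 then decompose_from (rcons s b) p'
    else let D := decompose_from [::] p' in
         (Block (strip_ones s) (trailing_ones s).+1 w b :: D.1, D.2)
  else ([::], s).

Definition decompose p : seq block * seq nat := decompose_from [::] p.

Definition dual_pair p : seq (K * nat) := dual_assemble (decompose p).

(* The pair (z over k)_(b_1, ..., b_d'): the i-th column (z_i, l_i) with
   z_i <> 1 becomes ({z_i}^(b_i + 1) over {1}^(b_i), l_i). *)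
Fixpoint expand_pair p (b : seq nat) : seq (K * nat) :=
  if p is (x, l) :: p' then
    if x == 1 then (x, l) :: expand_pair p' b
    else nseq (head 0%N b) (x, 1%N) ++ (x, l) :: expand_pair p' (behead b)
  else [::].

End Pairs.

Definition dual_condition (R : realType) (z : seq R[i]) (k : seq nat) : Prop :=
  [/\ forall x, x \in z ->
        [/\ `|x| <= 1, x != 0 & complex.Re x <= 1 / 2] \/ x = 1,
      complex.Re (head 1 z) != 1 / 2 &
      ~~ admissible k -> `|last 1 z| != 1].

Lemma index_blocks_fromK a k : is_index k -> admissible k ->
  index_of_blocks (index_blocks_from a.+1 k)
    = (if k is [::] then [::] else nseq a 1%N ++ k).
Proof.
elim: k a => [|x k IH] a //= /andP[x_gt0 ik].
rewrite /admissible /= => ak.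
case: eqP => [x1|/eqP x1]; last first.
  rewrite /index_of_blocks /= -/(index_of_blocks _).
  case: k IH ik ak => [|y k] IH ik ak.
    by rewrite /= cats0 prednK // cats1.
  rewrite IH // ?prednK //=; first by rewrite cat_rcons.
case: k IH ik ak => [|y k] IH ik ak; first by rewrite /= x1 in ak.
by rewrite IH // x1 -addn1 nseqD -catA.
Qed.

Lemma index_blocksK k : is_index k -> admissible k ->
  index_of_blocks (index_blocks k) = k.
Proof. by move=> ik ak; rewrite index_blocks_fromK //; case: k ik ak. Qed.

Lemma wf_index_blocks_from a k : is_index k ->
  wf_index_blocks (index_blocks_from a.+1 k).
Proof.
elim: k a => [|x k IH] a //= /andP[x_gt0 ik].
case: eqP => [_|/eqP x1]; first exact: IH.
by rewrite /= [X in _ && X]IH // andbT; case: x x_gt0 x1 => [|[]].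
Qed.

Lemma index_of_blocksK ab : wf_index_blocks ab ->
  index_blocks (index_of_blocks ab) = ab.
Proof.
rewrite /index_blocks; elim: ab => [|[a b] ab IH] //= /andP[/andP[a0 b0] /IH E].
rewrite /index_of_blocks /= -/(index_of_blocks _).
have aux n m : index_blocks_from m (rcons (nseq n 1%N) b.+1 ++ index_of_blocks ab)
    = ((n + m)%N, b) :: ab.
  elim: n m => [|n IHn] m /=; last by rewrite IHn addnS.
  by rewrite E; case: b b0.
by rewrite aux addn1 prednK.
Qed.

Lemma dual_index_of_blocks ab : wf_index_blocks ab ->
  dual_index (index_of_blocks ab)
    = index_of_blocks [seq (x.2, x.1) | x <- rev ab].
Proof. by move=> /index_of_blocksK E; rewrite /dual_index E. Qed.

Lemma trailing_ones_rcons s x :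
  trailing_ones (rcons s x) = if x == 1%N then (trailing_ones s).+1 else 0%N.
Proof. by rewrite /trailing_ones rev_rcons /=; case: eqP. Qed.

Lemma trailing_ones_le s : (trailing_ones s <= size s)%N.
Proof. by rewrite -(size_rev s) find_size. Qed.

Lemma strip_ones_rcons s x :
  strip_ones (rcons s x) = if x == 1%N then strip_ones s else rcons s x.
Proof.
rewrite /strip_ones trailing_ones_rcons size_rcons.
case: eqP => _; last by rewrite subn0 -(size_rcons s x) take_size.
by rewrite subSS -cats1 takel_cat // leq_subr.
Qed.

Lemma strip_onesK s : strip_ones s ++ nseq (trailing_ones s) 1%N = s.
Proof.
elim/last_ind: s => [|s x IH] //.
rewrite strip_ones_rcons trailing_ones_rcons.
case: eqP => [->|_]; last by rewrite cats0.
by rewrite -addn1 nseqD catA IH cats1.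
Qed.

Lemma admissible_rcons s x : admissible (rcons s x) = (2 <= x)%N.
Proof. by rewrite /admissible last_rcons. Qed.

Lemma strip_ones_adm s : is_index s ->
  is_index (strip_ones s) && admissible (strip_ones s).
Proof.
elim/last_ind: s => [|s x IH] //.
rewrite /is_index all_rcons => /andP[x0 is0]; rewrite strip_ones_rcons.
case: eqP => [_|/eqP x1]; first exact: IH.
by rewrite admissible_rcons all_rcons x0 is0 /=; case: x x0 x1 => [|[]].
Qed.

Lemma strip_ones_cat l n : is_index l -> admissible l ->
  strip_ones (l ++ nseq n 1%N) = l /\ trailing_ones (l ++ nseq n 1%N) = n.
Proof.
move=> il al; elim: n => [|n [IHs IHt]].
  rewrite cats0; case/lastP: l il al => [|l x] // _.
  rewrite admissible_rcons strip_ones_rcons trailing_ones_rcons.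
  by case: x => [|[]].
rewrite -addn1 nseqD catA cats1.
by rewrite strip_ones_rcons trailing_ones_rcons /= IHs IHt addn1.
Qed.

Section Decomposition.
Variable K : numFieldType.
Implicit Type p : seq (K * nat).

Lemma decompose_fromK s p : assemble (decompose_from s p) = ones K s ++ p.
Proof.
elim: p s => [|[w b] p IH] s /=; first by rewrite /assemble /= cats0.
case: eqP => [->|_].
  by rewrite IH /ones map_rcons cat_rcons.
rewrite /assemble /= -catA -/(assemble (decompose_from [::] p)) IH /=.
rewrite /block_cols /= -!catA /= catA; congr (_ ++ _).
by rewrite /ones -map_cat strip_onesK.
Qed.

Lemma decomposeK p : assemble (decompose p) = p.
Proof. exact: decompose_fromK. Qed.

Lemma wf_decompose p : is_index (unzip2 p) ->
  (~~ admissible (unzip2 p) -> last 1 (unzip1 p) != 1) ->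
  wf_decomp (decompose p).
Proof.
move=> ip hp; rewrite /decompose.
suff gen s : is_index s ->
    (~~ admissible (s ++ unzip2 p) ->
      (p != [::]) && (last 1 (unzip1 p) != 1)) ->
    wf_decomp (decompose_from s p).
  by apply: gen => //=; case: p ip hp => [|c p] _ hp //= /hp.
elim: p s ip {hp} => [|[w b] p IH] s /=.
  move=> _; rewrite cats0 /wf_decomp /= => -> h.
  by case: admissible h => // /(_ isT).
move=> /andP[b0 ip] is0 h; case: eqP => [w1|/eqP w1].
  apply: IH => //; first by rewrite /is_index all_rcons b0.
  by rewrite cat_rcons => /h; rewrite w1; case: (p) => //=; rewrite eqxx.
rewrite /wf_decomp /=.
have /and3P[-> -> ->] : wf_decomp (decompose_from [::] p).
  apply: IH => //=; case: (p) h => [|c q] //= h np; apply: h.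
  by move: np; rewrite /admissible /= last_cat.
by rewrite /wf_block /= w1 b0 !andbT; have /andP[-> ->] := strip_ones_adm is0.
Qed.

Lemma decompose_from_ones s l p :
  decompose_from s (ones K l ++ p) = decompose_from (s ++ l) p.
Proof.
elim: l s => [|x l IH] s /=; first by rewrite cats0.
by rewrite eqxx IH cat_rcons.
Qed.

Lemma assembleK (D : seq (block K) * seq nat) :
  wf_decomp D -> decompose (assemble D) = D.
Proof.
case: D => bs l /and3P[/= wb il al]; rewrite /decompose.
elim: bs wb => [|[l' a w b] bs IH] /=.
  by move=> _; rewrite /assemble /= -[ones K l]cats0 decompose_from_ones.
move=> /andP[/and5P[/= il' al' a0 b0 w1] /IH E].
rewrite /assemble /= /block_cols /= -!catA !decompose_from_ones /=.
rewrite (negPf w1) -/(assemble (bs, l)) E.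
by have [-> ->] := strip_ones_cat a.-1 il' al'; rewrite prednK.
Qed.

Lemma dual_assembleE (D : seq (block K) * seq nat) :
  wf_decomp D -> dual_pair (assemble D) = dual_assemble D.
Proof. by move=> /assembleK E; rewrite /dual_pair E. Qed.

End Decomposition.

Lemma dual_condition_wf (R : realType) (k : seq nat) (z : seq R[i]) :
  size z = size k -> is_index k -> dual_condition z k ->
  wf_decomp (decompose (zip z k)).
Proof.
move=> szk ik [_ _ h]; apply: wf_decompose.
  by rewrite unzip2_zip // szk.
rewrite unzip2_zip ?szk // unzip1_zip ?szk // => /h.
by apply: contraNneq => ->; rewrite normr1.
Qed.

(* Main.v *)
Require Import Defs.
From HB Require Import structures.
From mathcomp Require Import all_boot all_order all_algebra.
From mathcomp Require Import complex ring lra zify.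
From mathcomp Require Import all_classical all_reals all_analysis.
Set Implicit Arguments.
Unset Strict Implicit.
Unset Printing Implicit Defensive.
Import Order.TTheory GRing.Theory Num.Theory.
Import numFieldNormedType.Exports.
Local Open Scope ring_scope.

(** The generating series in [x] of the [O_h] of a pair is its shuffle series with
    every [1 / m^k] replaced by [1 / ((m - x) m^(k-1))]; summing over the expansions
    of the dual pair multiplies the factor of a column with [w <> 1] by
    [prod_(n < j < n') j / (j - x)], where [n < n'] are the summation variables of
    the previous column and of this one.  Both series are ends of a chain of connected
    sums [sum_(m, n) f m * g n * C m n] with connector
    [C m n = prod_(i <= m) (i - x) prod_(i <= n) (i - x) / prod_(i <= m + n) (i - x)].
    Cutting all sums at [N], one step of the chain, which moves the outermost letter
    of [f] to [g], is an exact identity with a boundary term: it telescopes for the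
    letters [1 / (m - x)] and [1 / m], and for [z <> 1] it is the vanishing of the
    circulation of a closed cochain around the square [m, N] x [n, N], closedness
    being the equation [z + w = z w] satisfied by [w = z / (z - 1)].  Modulo
    [x^(h+1)] the boundary terms are [O((log N)^j / N)], so no interchange of
    infinite sums is needed and only the two end series must converge. *)

(** * Connectors *)

(** Discrete Stokes theorem: [f] weighs horizontal edges and [g], up to sign, vertical ones. The
    hypothesis is the vanishing of the circulation around each unit square, and inner edges
    cancel. *)
Lemma sum_rectangle (V : zmodType) (f g : nat -> nat -> V) M N :
  (forall i j, f i j + g i j = f i j.+1 + g i.+1 j) ->
  \sum_(0 <= i < M) f i 0%N + \sum_(0 <= j < N) g 0%N j
  = \sum_(0 <= i < M) f i N + \sum_(0 <= j < N) g M j.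
Proof.
move=> fg; elim: M => [|M IH]; first by rewrite !(big_geq (leqnn 0)).
have col : f M 0%N + \sum_(0 <= j < N) g M j
    = f M N + \sum_(0 <= j < N) g M.+1 j.
  elim: N {IH} => [|N IH]; first by rewrite !(big_geq (leqnn 0)).
  rewrite !big_nat_recr //= addrA IH addrAC fg -addrA.
  by congr (_ + _); rewrite addrC.
rewrite !(@big_nat_recr _ _ _ M) //= addrAC IH -addrA.
by rewrite (addrC (\sum_(0 <= j < N) _)) col addrA.
Qed.

Lemma sum_triangle (V : nmodType) (F : nat -> nat -> V) N :
  \sum_(0 <= a < N.+1) \sum_(0 <= m < a) F m a
  = \sum_(0 <= m < N.+1) \sum_(m <= a < N) F m a.+1.
Proof.
elim: N => [|N IH].
  by rewrite !big_nat1 !(big_geq (leqnn 0)).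
rewrite big_nat_recr //= IH [RHS]big_nat_recr //= [X in _ = _ + X]big_geq // addr0.
rewrite -big_split /=; apply: eq_big_nat => m mN.
by rewrite big_nat_recr //=; case/andP: mN.
Qed.

Section Connector.
Variables (A : comNzRingType) (x : A) (iv nv : nat -> A).
Hypothesis ivP : forall i, (0 < i)%N -> (i%:R - x) * iv i = 1.
Hypothesis nvP : forall i, (0 < i)%N -> i%:R * nv i = 1.

Definition rfact n : A := \prod_(1 <= i < n.+1) (i%:R - x).
Definition ivfact n : A := \prod_(1 <= i < n.+1) iv i.
Definition connector m n : A := rfact m * rfact n * ivfact (m + n).
(** For [m < a], [ratio m a * nv a] is [iv a] times the product of [j / (j - x)] over [m < j < a],
    the weight of a dual column with [w <> 1]. *)
Definition ratio m n : A := \prod_(m.+1 <= i < n.+1) (i%:R * iv i).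

Lemma rfactS n : rfact n.+1 = rfact n * (n.+1%:R - x).
Proof. by rewrite /rfact big_nat_recr. Qed.

Lemma ivfactS n : ivfact n.+1 = ivfact n * iv n.+1.
Proof. by rewrite /ivfact big_nat_recr. Qed.

Lemma rfactK n : rfact n * ivfact n = 1.
Proof.
elim: n => [|n IH]; first by rewrite /rfact /ivfact !big_geq // mulr1.
rewrite rfactS ivfactS mulrACA IH mul1r; exact: ivP.
Qed.

Lemma connectorC m n : connector m n = connector n m.
Proof. by rewrite /connector addnC (mulrC (rfact m)). Qed.

Lemma connectorn0 m : connector m 0 = 1.
Proof. by rewrite /connector addn0 {2}/rfact big_geq // mulr1 rfactK. Qed.

Lemma connector_succ m n :
  connector m n.+1 = connector m n * iv (m + n).+1 * (n.+1%:R - x).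
Proof. by rewrite /connector addnS rfactS ivfactS; ring. Qed.

(** The factors [m + n + 1 - x] and [n + 1 - x] differ by the integer [m], free of [x]; this turns a
    letter [1 / (n - x)] on one side into a division by [m] on the other. *)
Lemma connector_diff m n :
  connector m n - connector m n.+1 = m%:R * (iv n.+1 * connector m n.+1).
Proof.
have e1 := ivP (ltn0Sn n); have e2 := ivP (ltn0Sn (m + n)).
rewrite connector_succ -[X in X - _]mulr1 -[X in _ * X - _]e2 mulrCA.
have -> : (m + n).+1%:R = m%:R + n.+1%:R :> A by rewrite -natrD addnS.
transitivity (connector m n * iv (m + n).+1 * m%:R); first by ring.
by rewrite -[LHS]mulr1 -[X in _ * X = _]e1; ring.
Qed.

(** After division by [m], [connector_diff] telescopes; [connector m N] is the boundary term of the
    cut at [N]. *)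
Lemma sum_connector m b N : (0 < m)%N -> (b <= N)%N ->
  \sum_(b <= n < N) iv n.+1 * connector m n.+1 = nv m * (connector m b - connector m N).
Proof.
move=> m0 bN; rewrite -[LHS]mul1r -(nvP m0) (mulrC m%:R) -mulrA; congr (_ * _).
rewrite mulr_sumr; under eq_bigr do rewrite -connector_diff.
rewrite -[RHS]opprB -(telescope_sumr (connector m)) // -sumrN.
by apply: eq_bigr => i _; rewrite opprB.
Qed.

Lemma ratio_id m : ratio m m = 1.
Proof. by rewrite /ratio big_geq. Qed.

Lemma ratioS m n : (m <= n)%N -> ratio m n.+1 = ratio m n * (n.+1%:R * iv n.+1).
Proof. by move=> mn; rewrite /ratio big_nat_recr. Qed.

(* The weights of the horizontal edges (m+i, n+j) - (m+i+1, n+j) and of the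
   vertical edges (m+i, n+j) - (m+i, n+j+1) form a closed cochain. *)
Lemma connector_cochain z w m n i j : z + w = z * w ->
  let f i j := z ^+ i.+1 * w ^+ j * ratio n (n + j)
                 * (iv (m + i).+1 * connector (m + i).+1 (n + j)) in
  let g i j := z ^+ i * w ^+ j.+1 * (ratio n (n + j).+1 * nv (n + j).+1)
                 * connector (m + i) (n + j).+1 in
  f i j + g i j = f i j.+1 + g i.+1 j.
Proof.
move=> zw /=; rewrite !addnS ratioS ?leq_addr //.
set a := (m + i)%N; set b := (n + j)%N; set P := ratio n b.
have e1 := ivP (ltn0Sn a); have e2 := ivP (ltn0Sn b); have e3 := nvP (ltn0Sn b).
have e4 := ivP (ltn0Sn (a.+1 + b)).
have cS : connector a.+1 b = connector a b * iv (a + b).+1 * (a.+1%:R - x).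
  by rewrite connectorC connector_succ connectorC addnC.
rewrite !connector_succ cS; set Q := connector a b * iv _; set J := iv (a.+1 + b).+1.
(* [J] inverts the sum in parentheses, which is [a + b + 2 - x]; here [z + w = z * w] enters. *)
have zwJ : z * w * J * (a.+1%:R - x + b.+1%:R) = z + w.
  rewrite zw -[RHS]mulr1 -[X in _ = _ * X]e4 -/J.
  have -> : (a.+1 + b).+1%:R = a.+1%:R + b.+1%:R :> A by rewrite -natrD addnS.
  by ring.
transitivity (z ^+ i * w ^+ j * P * Q * (z * ((a.+1%:R - x) * iv a.+1) +
  w * ((b.+1%:R - x) * iv b.+1 * (b.+1%:R * nv b.+1)))).
  by rewrite !exprS; ring.
transitivity (z ^+ i * w ^+ j * P * Q * (z * w * J *
  ((a.+1%:R - x) * ((b.+1%:R - x) * iv b.+1 * (b.+1%:R * nv b.+1)) + b.+1%:R *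
   ((a.+1%:R - x) * iv a.+1 * ((b.+1%:R - x) * iv b.+1))))); last first.
  by rewrite !exprS; ring.
by rewrite e1 e2 e3 !mulr1 zwJ.
Qed.

(** The left-hand sums run along the two edges of [[m, N] x [n, N]] through [(m, n)], the right-hand
    ones along the opposite edges, where one argument of the connector is [N]. *)
Lemma sum_connector_z z w m n N : z + w = z * w -> (m <= N)%N -> (n <= N)%N ->
  \sum_(m <= a < N) z ^+ (a.+1 - m) * (iv a.+1 * connector a.+1 n) +
  \sum_(n <= b < N) w ^+ (b.+1 - n) * (ratio n b.+1 * nv b.+1) * connector m b.+1
  = w ^+ (N - n) * ratio n N *
      (\sum_(m <= a < N) z ^+ (a.+1 - m) * (iv a.+1 * connector a.+1 N)) +
    z ^+ (N - m) *
      (\sum_(n <= b < N) w ^+ (b.+1 - n) * (ratio n b.+1 * nv b.+1)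
         * connector N b.+1).
Proof.
move=> zw mN nN.
have := @sum_rectangle A _ _ (N - m) (N - n) (fun i j => connector_cochain m n i j zw).
have sh (F : nat -> A) k : (k <= N)%N ->
    \sum_(k <= a < N) F a = \sum_(0 <= i < N - k) F (k + i)%N.
  by move=> kN; rewrite -{1}[k]add0n big_addn; apply: eq_bigr => i _; rewrite addnC.
rewrite !sh //= !expr0 !addn0 ratio_id !subnKC // => E.
rewrite !mulr_sumr; move: E; congr (_ + _ = _ + _); apply: eq_bigr => i _.
- by rewrite -addnS addKn mulr1 mulr1.
- by rewrite -addnS addKn mul1r.
- by rewrite -addnS addKn; ring.
- by rewrite -addnS addKn !mulrA.
Qed.
End Connector.

(** * Words and connected sums *)

(** A form of [prod (1 + a i) <= 1 / (1 - sum a i)] that needs no sign for the denominator; the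
    inductive step loses [a n * S + a n ^+ 2], which is nonnegative. *)
Lemma prod1D_le (F : numFieldType) (a : nat -> F) m n :
  (forall i, 0 <= a i) ->
  \prod_(m <= i < n) (1 + a i) * (1 - \sum_(m <= i < n) a i) <= 1.
Proof.
move=> a0; elim: n => [|n IH]; first by rewrite !big_geq // subr0 mulr1.
have [mn|nm] := leqP m n; last by rewrite !big_geq // subr0 mulr1.
rewrite !big_nat_recr //=; apply: le_trans IH; rewrite -mulrA ler_wpM2l //.
  by apply: prodr_ge0 => i _; rewrite addr_ge0.
set S := \sum_(_ <= _ < _) _.
have S0 : 0 <= S by apply: sumr_ge0.
rewrite -subr_ge0 (_ : _ - _ = a n * S + a n ^+ 2); last by ring.
by rewrite addr_ge0 ?mulr_ge0 ?exprn_ge0.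
Qed.

Definition harm (F : numFieldType) n : F := \sum_(1 <= i < n.+1) i%:R^-1.

Lemma harm_ge0 (F : numFieldType) n : 0 <= harm F n.
Proof. by apply: sumr_ge0 => i _; rewrite invr_ge0. Qed.

Lemma harm_le (F : numFieldType) m n : (m <= n)%N -> harm F m <= harm F n.
Proof.
move=> mn; rewrite /harm [leRHS](@big_cat_nat _ _ _ m.+1) //=.
by rewrite lerDl; apply: sumr_ge0 => i _; rewrite invr_ge0.
Qed.

Lemma sum_inv_le_harm (F : numFieldType) m n N : (0 < m)%N -> (n <= N.+1)%N ->
  \sum_(m <= i < n) i%:R^-1 <= harm F N.
Proof.
move=> m0 nN; have [mn|nm] := leqP m n; last first.
  by rewrite big_geq ?harm_ge0 // ltnW.
apply: (@le_trans _ _ (harm F n.-1)); last by apply: harm_le; case: n nN {mn}.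
rewrite /harm (prednK (leq_trans m0 mn)) [leRHS](@big_cat_nat _ _ _ m) //=.
by rewrite lerDr; apply: sumr_ge0 => i _; rewrite invr_ge0.
Qed.

(** The left side is the inverse of ['C(m + n, m)], which is at least ['C(m + 1, m) = m + 1] as
    [n > 0]. This gives the decay of the boundary terms. *)
Lemma fact_ratio_le (F : numFieldType) m n : (0 < n)%N ->
  (m`! * n`!)%:R / (m + n)`!%:R <= m.+1%:R^-1 :> F.
Proof.
move=> n0; have E := bin_fact (leq_addl m n); rewrite addnK in E.
have f0 k : k`!%:R != 0 :> F by rewrite pnatr_eq0 -lt0n fact_gt0.
rewrite -E (mulnC n`!) [X in _ / X]natrM invfM mulrCA divff ?mulr1; last first.
  by rewrite natrM mulf_neq0.
rewrite lef_pV2 ?posrE ?ltr0n ?bin_gt0 ?leq_addl // ler_nat.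
rewrite -bin_sub ?leq_addl // addnK -[m.+1]binSn -addn1.
by apply: leq_bin2l; rewrite leq_add2l.
Qed.

(* A column (z, k) is read as the letter [Some z], a summation with weight
   z^(a - m), followed by k - 1 letters [None], divisions by the outer variable. *)
Definition dual_letter (F : numFieldType) (l : option F) : option F :=
  if l is Some z then if z == 1 then None else Some (z / (z - 1)) else Some 1.

(** For [z <> 1] the two near edges of the square sum to a boundary term, so moving such a letter
    changes the sign. *)
Definition sgn_letter (F : numFieldType) (l : option F) : F :=
  if l is Some z then if z == 1 then 1 else -1 else 1.

(** Both the letter and its dual have modulus at most 1, so that words stay bounded on either side
    of the connected sum. *)
Definition good_letter (F : numFieldType) (l : option F) : bool :=
  if l is Some z then (z == 1) || (`|z| <= 1) && (`|z / (z - 1)| <= 1) else true.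

Section Operators.
Variables (F : numFieldType) (A : comAlgType F) (x : A) (iv : nat -> A).

Definition nv n : A := (n%:R^-1 : F)%:A.
Definition kerL (z : F) m a : A := z ^+ (a - m) *: iv a.
(* For z <> 1 this is the sum over b of x^b times the b-fold insertion of [kerL z]:
   see [kerR_resolvent]. *)
Definition kerR (z : F) m a : A :=
  if z == 1 then iv a else z ^+ (a - m) *: (ratio iv m a * nv a).
Definition integ (ker : nat -> nat -> A) (f : nat -> A) a : A :=
  \sum_(0 <= m < a) f m * ker m a.
Definition letter_op (ker : F -> nat -> nat -> A) (l : option F) (f : nat -> A) a : A :=
  if l is Some z then integ (ker z) f a else nv a * f a.
Definition letter_opL := letter_op kerL.
Definition letter_opR := letter_op kerR.
(* The head of [v] is the outermost letter, i.e. words are read backwards. *)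
Definition wordL (v : seq (option F)) : nat -> A :=
  foldr letter_opL (fun m => (m == 0)%:R) v.
Definition wordR (v : seq (option F)) : nat -> A :=
  foldr letter_opR (fun m => (m == 0)%:R) v.

Definition connected_sum N (f g : nat -> A) : A :=
  \sum_(0 <= m < N.+1) \sum_(0 <= n < N.+1) f m * g n * connector x iv m n.

Lemma nvP i : (0 < i)%N -> i%:R * nv i = 1.
Proof.
move=> i0; rewrite /nv mulr_algr -(scaler_nat i (1 : A)) scalerA.
by rewrite mulVf ?scale1r // pnatr_eq0 -lt0n.
Qed.

(** Vanishing at 0 allows the division by the summation variable in [sum_connector]. For [None] it
    rests on the convention [0^-1 = 0]. *)
Lemma wordL0 l v : wordL (l :: v) 0 = 0.
Proof. by case: l => [z|] /=; rewrite /integ ?big_geq // /nv invr0 scale0r mul0r. Qed.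

Lemma wordR0 l v : wordR (l :: v) 0 = 0.
Proof. by case: l => [z|] /=; rewrite /integ ?big_geq // /nv invr0 scale0r mul0r. Qed.

(** Exchanging the sums puts kernel and connector alone in the inner sum, in the shape treated by
    [sum_connector] and [sum_connector_z]. *)
Lemma connected_sum_integl N ker f g : connected_sum N (integ ker f) g =
  \sum_(0 <= m < N.+1) \sum_(0 <= n < N.+1)
    f m * g n * \sum_(m <= a < N) ker m a.+1 * connector x iv a.+1 n.
Proof.
rewrite /connected_sum exchange_big [RHS]exchange_big /=; apply: eq_bigr => n _.
transitivity (g n * \sum_(0 <= m < N.+1) \sum_(0 <= j < m)
   f j * ker j m * connector x iv m n).
  rewrite mulr_sumr; apply: eq_bigr => m _.
  by rewrite -mulr_suml /integ; ring.
rewrite sum_triangle mulr_sumr; apply: eq_bigr => m _.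
by rewrite !mulr_sumr; apply: eq_bigr => a _; ring.
Qed.

Lemma connected_sumC N f g : connected_sum N f g = connected_sum N g f.
Proof.
rewrite /connected_sum exchange_big; apply: eq_bigr => n _; apply: eq_bigr => m _ /=.
by rewrite connectorC (mulrC (f m)).
Qed.

Lemma connected_sum_integr N ker f g : connected_sum N f (integ ker g) =
  \sum_(0 <= m < N.+1) \sum_(0 <= n < N.+1)
    f m * g n * \sum_(n <= b < N) ker n b.+1 * connector x iv m b.+1.
Proof.
rewrite connected_sumC connected_sum_integl exchange_big /=; apply: eq_bigr => m _.
apply: eq_bigr => n _; rewrite (mulrC (g n)); congr (_ * _).
by apply: eq_bigr => a _; rewrite connectorC.
Qed.

Hypothesis ivP : forall i, (0 < i)%N -> (i%:R - x) * iv i = 1.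

(** The connector is 1 when one argument is 0, so the ends of the chain are the truncated series
    themselves. *)
Lemma connected_sum_deltar N f : connected_sum N f (fun m => (m == 0)%:R)
  = \sum_(0 <= m < N.+1) f m.
Proof.
apply: eq_bigr => m _; rewrite big_nat_recl //= big1 ?addr0.
  by rewrite connectorn0 // !mulr1.
by move=> i _; rewrite mulr0 mul0r.
Qed.

Lemma connected_sum_deltal N f : connected_sum N (fun m => (m == 0)%:R) f
  = \sum_(0 <= m < N.+1) f m.
Proof. by rewrite connected_sumC connected_sum_deltar. Qed.

End Operators.

Lemma algX (F : numFieldType) (A : comAlgType F) (c : F) k :
  c%:A ^+ k = (c ^+ k)%:A :> A.
Proof. exact/esym/(rmorphXn (in_alg A)). Qed.

(** * Norm estimates and the transport of letters *)

Section Norm.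
Variables (F : numFieldType) (A : comAlgType F) (x : A) (iv : nat -> A).
Variables (nu : A -> F) (N : nat) (t : F).
Hypothesis ivP : forall i, (0 < i)%N -> (i%:R - x) * iv i = 1.
Hypothesis nu_ge0 : forall a, 0 <= nu a.
Hypothesis nuD : forall a b, nu (a + b) <= nu a + nu b.
Hypothesis nuM : forall a b, nu (a * b) <= nu a * nu b.
Hypothesis nuZ : forall c a, nu (c *: a) = `|c| * nu a.
Hypothesis nu1 : nu 1 = 1.
Hypothesis t_ge : 4 * (1 + harm F (N + N)) <= t.
Hypothesis nu_sub : forall i, (0 < i)%N ->
  nu (i%:R - x) <= i%:R * (1 + 2 / (t * i%:R)).
Hypothesis nu_iv : forall i, (0 < i)%N ->
  nu (iv i) <= i%:R^-1 * (1 + 2 / (t * i%:R)).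

Let t_gt0 : 0 < t.
Proof.
apply: lt_le_trans t_ge; rewrite mulr_gt0 // ltr_wpDr ?harm_ge0 //.
Qed.

Let t_ge1 : 1 <= t.
Proof.
apply: le_trans t_ge; rewrite mulrDr mulr1 -[leLHS]addr0 lerD ?ler1n //.
by rewrite mulr_ge0 ?harm_ge0.
Qed.

Let nu0 : nu 0 = 0.
Proof. by rewrite -(scale0r (0 : A)) nuZ normr0 mul0r. Qed.

Lemma nu_sum (I : Type) (r : seq I) (P : pred I) (f : I -> A) :
  nu (\sum_(i <- r | P i) f i) <= \sum_(i <- r | P i) nu (f i).
Proof.
elim/big_rec2: _ => [|i a b _ ba]; first by rewrite nu0.
by apply: le_trans (nuD _ _) _; rewrite lerD2l.
Qed.

Lemma nu_prod (I : Type) (r : seq I) (P : pred I) (f : I -> A) :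
  nu (\prod_(i <- r | P i) f i) <= \prod_(i <- r | P i) nu (f i).
Proof.
elim/big_rec2: _ => [|i a b _ ba]; first by rewrite nu1.
by apply: le_trans (nuM _ _) _; rewrite ler_wpM2l.
Qed.

Lemma nu_scale_le c a B : `|c| <= 1 -> nu a <= B -> nu (c *: a) <= B.
Proof.
move=> c1 aB; rewrite nuZ; apply: le_trans aB.
by rewrite -[leRHS]mul1r ler_wpM2r.
Qed.

Lemma nuM_le a b B C : nu a <= B -> nu b <= C -> nu (a * b) <= B * C.
Proof. by move=> aB bC; apply: le_trans (nuM _ _) _; rewrite ler_pM. Qed.

(** The choice of [t] makes the sum of the [2 / (t * i)] at most [2 * harm F (N + N) / t <= 1 / 2];
    [prod1D_le] then bounds the product by 2. *)
Lemma prod_corr_le2 m n : (0 < m)%N -> (n <= (N + N).+1)%N ->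
  \prod_(m <= i < n) (1 + 2 / (t * i%:R)) <= 2.
Proof.
move=> m0 nN.
have c0 i : 0 <= 2 / (t * i%:R) by rewrite divr_ge0 // mulr_ge0 // ltW.
have := prod1D_le m n c0.
set P := \prod_(_ <= _ < _) _; set S := \sum_(_ <= _ < _) _ => PS.
have P0 : 0 <= P by apply: prodr_ge0 => i _; rewrite addr_ge0.
have S2 : S <= 2^-1.
  have -> : S = 2 / t * \sum_(m <= i < n) i%:R^-1.
    by rewrite /S mulr_sumr; apply: eq_bigr => i _; rewrite invfM mulrA.
  rewrite mulrAC ler_pdivrMr // -(@ler_pM2l _ 2) // !mulrA divff ?pnatr_eq0 //.
  rewrite mul1r -natrM.
  apply: le_trans t_ge; rewrite ler_pM2l //.
  by apply: le_trans (sum_inv_le_harm _ m0 nN) _; rewrite lerDr.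
rewrite -[leRHS]mulr1 -(@ler_pM2r _ 2^-1) ?invr_gt0 // mulr1 divff ?pnatr_eq0 //.
apply: le_trans PS; rewrite ler_wpM2l // lerBrDr.
apply: le_trans (_ : 2^-1 + 2^-1 <= 1); first by rewrite lerD2l.
by rewrite [leRHS]splitr !mul1r.
Qed.

Lemma corr_le2 i : (0 < i <= N + N)%N -> 1 + 2 / (t * i%:R) <= 2.
Proof.
by move=> /andP[i0 iN]; have := @prod_corr_le2 i i.+1 i0 iN; rewrite big_nat1.
Qed.

Lemma nu_iv_le i : (0 < i <= N + N)%N -> nu (iv i) <= 2 / i%:R.
Proof.
move=> iN; have /andP[i0 _] := iN; apply: le_trans (nu_iv i0) _.
by rewrite mulrC ler_wpM2r ?invr_ge0 ?corr_le2.
Qed.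

Lemma fact_big_nat n : \prod_(1 <= i < n.+1) i%:R = n`!%:R :> F.
Proof. by rewrite fact_prod natr_prod. Qed.

Lemma nu_rfact n : (n <= N + N)%N -> nu (rfact x n) <= n`!%:R * 2.
Proof.
move=> nN; apply: le_trans (nu_prod _ _ _) _.
apply: (@le_trans _ _ (\prod_(1 <= i < n.+1) (i%:R * (1 + 2 / (t * i%:R))))).
  rewrite big_nat [leRHS]big_nat; apply: ler_prod => i /andP[i0 _].
  by rewrite nu_ge0 nu_sub.
rewrite big_split /= fact_big_nat ler_wpM2l //.
by rewrite prod_corr_le2.
Qed.

Lemma nu_ivfact n : (n <= N + N)%N -> nu (ivfact iv n) <= n`!%:R^-1 * 2.
Proof.
move=> nN; apply: le_trans (nu_prod _ _ _) _.
apply: (@le_trans _ _ (\prod_(1 <= i < n.+1) (i%:R^-1 * (1 + 2 / (t * i%:R))))).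
  rewrite big_nat [leRHS]big_nat; apply: ler_prod => i /andP[i0 _].
  by rewrite nu_ge0 nu_iv.
rewrite big_split /= prodfV fact_big_nat ler_wpM2l ?invr_ge0 //.
by rewrite prod_corr_le2.
Qed.

Lemma nu_ratio m n : (n <= N + N)%N -> nu (ratio iv m n) <= 2.
Proof.
move=> nN; apply: le_trans (nu_prod _ _ _) _.
apply: le_trans (prod_corr_le2 (ltn0Sn m) (n := n.+1) nN).
rewrite big_nat [leRHS]big_nat; apply: ler_prod => i /andP[i0 _].
have {}i0 : (0 < i)%N by apply: leq_trans i0.
rewrite nu_ge0 -(scaler_nat i (1 : A)) mulr_algl nuZ normr_nat /=.
apply: (@le_trans _ _ (i%:R * (i%:R^-1 * (1 + 2 / (t * i%:R))))).
  by rewrite ler_wpM2l // nu_iv.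
by rewrite mulrA divff ?mul1r // pnatr_eq0 -lt0n.
Qed.

Lemma nu_nv n : nu (nv A n) <= n%:R^-1.
Proof. by rewrite /nv nuZ nu1 mulr1 normfV normr_nat. Qed.

(** Each of the three products costs a factor 2 over its value at [x = 0], whence 8; what remains is
    an inverse binomial coefficient. *)
Lemma nu_connector n : (0 < n <= N)%N -> nu (connector x iv N n) <= 8 / N.+1%:R.
Proof.
move=> /andP[n0 nN]; rewrite /connector.
have le2 k : (k <= N)%N -> (k <= N + N)%N by move/leq_trans; apply; exact: leq_addl.
apply: le_trans (nuM_le (nuM_le (nu_rfact (le2 _ (leqnn N)))
  (nu_rfact (le2 _ nN))) (nu_ivfact _)) _; first by rewrite leq_add2l.
rewrite [leLHS](_ : _ = 8 * ((N`! * n`!)%:R / (N + n)`!%:R)).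
  by rewrite ler_pM2l // fact_ratio_le.
by rewrite natrM; ring.
Qed.

Lemma nu_kerL z m a : `|z| <= 1 -> (0 < a <= N)%N -> nu (kerL iv z m a) <= 2 / a%:R.
Proof.
move=> z1 /andP[a0 aN]; apply: nu_scale_le; last first.
  by rewrite nu_iv_le // a0 (leq_trans aN) ?leq_addl.
by rewrite normrX exprn_ile1.
Qed.

Lemma nu_kerR z m a : `|z| <= 1 -> (0 < a <= N)%N -> nu (kerR iv z m a) <= 2 / a%:R.
Proof.
move=> z1 /andP[a0 aN]; rewrite /kerR; case: ifP => _.
  by rewrite nu_iv_le // a0 (leq_trans aN) ?leq_addl.
apply: nu_scale_le; first by rewrite normrX exprn_ile1.
by apply: nuM_le; rewrite ?nu_ratio ?nu_nv // (leq_trans aN) ?leq_addl.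
Qed.

Definition mass (f : nat -> A) : F := \sum_(0 <= m < N.+1) nu (f m).

Lemma mass_ge0 f : 0 <= mass f.
Proof. by apply: sumr_ge0. Qed.

Let sum_inv_le_t m : \sum_(m <= a < N) 2 / a.+1%:R <= t.
Proof.
apply: le_trans t_ge; rewrite -mulr_sumr.
apply: ler_pM => //; [by apply: sumr_ge0 => i _; rewrite invr_ge0 | by rewrite ler_nat|].
rewrite (_ : \sum_(_ <= _ < _) _ = \sum_(m.+1 <= a < N.+1) a%:R^-1); last first.
  by rewrite big_add1.
apply: le_trans (sum_inv_le_harm _ (ltn0Sn m) (leqnn _)) _.
by apply: le_trans (harm_le _ (leq_addl N N)) _; rewrite lerDr.
Qed.

(** With the sums exchanged, each [nu (f m)] is multiplied by a sum of [2 / a], which is at most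
    [t]: a letter costs one factor [t]. *)
Lemma mass_integ ker f :
  (forall m a, (0 < a <= N)%N -> nu (ker m a) <= 2 / a%:R) ->
  mass (integ ker f) <= t * mass f.
Proof.
move=> kerB.
apply: (@le_trans _ _ (\sum_(0 <= a < N.+1) \sum_(0 <= m < a) nu (f m) * nu (ker m a))).
  apply: ler_sum => a _; apply: le_trans (nu_sum _ _ _) _.
  by apply: ler_sum => m _; exact: nuM.
rewrite sum_triangle mulr_sumr; apply: ler_sum => m _.
rewrite -mulr_sumr mulrC ler_wpM2r //; apply: le_trans (sum_inv_le_t m).
rewrite big_nat [leRHS]big_nat; apply: ler_sum => a /andP[_ aN].
by apply: kerB.
Qed.

Lemma mass_nv f : mass (fun a => nv A a * f a) <= t * mass f.
Proof.
rewrite mulr_sumr; apply: ler_sum => a _.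
apply: le_trans (nuM _ _) _; rewrite ler_wpM2r //.
apply: le_trans (nu_nv a) _; apply: le_trans t_ge1.
case: a => [|a]; first by rewrite invr0.
by rewrite invf_le1 ?ler1n ?ltr0n.
Qed.

Definition bounded_letter (l : option F) := if l is Some z then `|z| <= 1 else true.

Lemma mass_delta : mass (fun m => (m == 0)%:R) = 1.
Proof. by rewrite /mass big_nat_recl //= nu1 big1 ?addr0. Qed.

Lemma mass_wordL v : all bounded_letter v -> mass (wordL iv v) <= t ^+ size v.
Proof.
elim: v => [|l v IH] /=; first by rewrite mass_delta expr0.
move=> /andP[lb /IH mv].
apply: (@le_trans _ _ (t * mass (wordL iv v))); last by rewrite exprS ler_pM2l.
case: l lb => [z|] /= lb; last exact: mass_nv.
by apply: mass_integ => m a; exact: nu_kerL.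
Qed.

Lemma mass_wordR v : all bounded_letter v -> mass (wordR iv v) <= t ^+ size v.
Proof.
elim: v => [|l v IH] /=; first by rewrite mass_delta expr0.
move=> /andP[lb /IH mv].
apply: (@le_trans _ _ (t * mass (wordR iv v))); last by rewrite exprS ler_pM2l.
case: l lb => [z|] /= lb; last exact: mass_nv.
by apply: mass_integ => m a; exact: nu_kerR.
Qed.

(** The bound on [e] is asked only where [f] and [g] do not vanish, which lets the index 0 be
    excluded. *)
Lemma nu_bilin f g (e : nat -> nat -> A) B :
  (forall m n, (m <= N)%N -> (n <= N)%N -> f m != 0 -> g n != 0 -> nu (e m n) <= B) ->
  nu (\sum_(0 <= m < N.+1) \sum_(0 <= n < N.+1) f m * g n * e m n)
    <= B * (mass f * mass g).
Proof.
move=> eB; apply: le_trans (nu_sum _ _ _) _.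
rewrite mulr_suml mulr_sumr big_nat [leRHS]big_nat; apply: ler_sum => m /= mN.
apply: le_trans (nu_sum _ _ _) _.
rewrite mulr_sumr mulr_sumr big_nat [leRHS]big_nat; apply: ler_sum => n /= nN.
have [->|f0] := eqVneq (f m) 0; first by rewrite !mul0r nu0 mul0r mulr0.
have [->|g0] := eqVneq (g n) 0; first by rewrite mulr0 mul0r nu0 !mulr0.
apply: le_trans (nuM _ _) _; rewrite mulrC; apply: ler_pM => //.
by apply: eB.
Qed.

(** What is left is the boundary term: a connector at [N] divided by a positive integer in the
    telescoping cases, the two far edges of the square for [z <> 1]. The conditions at 0 keep that
    integer positive. *)
Lemma connected_sum_transport l f g : good_letter l ->
  (l = Some 1 -> g 0%N = 0) -> (l = None -> f 0%N = 0) ->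
  nu (connected_sum x iv N (letter_opL iv l f) g
      - sgn_letter l *: connected_sum x iv N f (letter_opR iv (dual_letter l) g))
    <= 24 * t / N.+1%:R * (mass f * mass g).
Proof.
have B8 m n : (0 < m)%N -> (0 < n <= N)%N ->
    nu (nv A m * connector x iv N n) <= 24 * t / N.+1%:R.
  move=> m0 nN; apply: le_trans (nuM_le (nu_nv _) (nu_connector nN)) _.
  apply: (@le_trans _ _ (1 * (8 / N.+1%:R))).
    by rewrite ler_wpM2r ?divr_ge0 // invf_le1 ?ler1n ?ltr0n.
  rewrite mul1r ler_wpM2r ?invr_ge0 //; apply: (@le_trans _ _ (24 * 1)).
    by rewrite mulr1 ler_nat.
  by rewrite ler_pM2l.
have nuN c : nu (- c) = nu c by rewrite -scaleN1r nuZ normrN1 mul1r.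
have comb e1 e2 s :
    \sum_(0 <= m < N.+1) \sum_(0 <= n < N.+1) f m * g n * e1 m n
    - s *: (\sum_(0 <= m < N.+1) \sum_(0 <= n < N.+1) f m * g n * e2 m n)
    = \sum_(0 <= m < N.+1) \sum_(0 <= n < N.+1) f m * g n * (e1 m n - s *: e2 m n).
  rewrite scaler_sumr -sumrB; apply: eq_bigr => m _.
  rewrite scaler_sumr -sumrB; apply: eq_bigr => n _.
  by rewrite mulrBr -scalerAr.
have nvl : connected_sum x iv N (fun a => nv A a * f a) g =
    \sum_(0 <= m < N.+1) \sum_(0 <= n < N.+1) f m * g n * (nv A m * connector x iv m n).
  by apply: eq_bigr => m _; apply: eq_bigr => n _; ring.
have nvr : connected_sum x iv N f (fun a => nv A a * g a) =
    \sum_(0 <= m < N.+1) \sum_(0 <= n < N.+1) f m * g n * (nv A n * connector x iv m n).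
  by apply: eq_bigr => m _; apply: eq_bigr => n _; ring.
case: l => [z|] /=; last first.
  move=> _ _ /(_ erefl) f0; rewrite connected_sum_integr nvl comb; apply: nu_bilin.
  move=> m n mN nN fm _.
  have m0 : (0 < m)%N by rewrite lt0n; apply: contraNneq fm => ->; rewrite f0.
  under eq_bigr do rewrite /kerR eqxx.
  rewrite scale1r (sum_connector ivP (@nvP _ A)) // -mulrBr opprB addrC subrK connectorC.
  by rewrite B8 // m0.
have [-> _ /(_ erefl) g0 _|z1 /=] := eqVneq z 1.
  rewrite connected_sum_integl nvr comb; apply: nu_bilin.
  move=> m n mN nN _ gn.
  have n0 : (0 < n)%N by rewrite lt0n; apply: contraNneq gn => ->; rewrite g0.
  under eq_bigr do rewrite /kerL expr1n scale1r connectorC.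
  rewrite scale1r (sum_connector ivP (@nvP _ A)) // -mulrBr connectorC addrAC subrr add0r.
  by rewrite mulrN nuN connectorC B8 // n0.
move=> /andP[zb wb] _ _; rewrite connected_sum_integl connected_sum_integr comb.
set w := z / (z - 1) in wb *.
have z10 : z - 1 != 0 by rewrite subr_eq0.
have zw : z%:A + w%:A = z%:A * w%:A :> A.
  rewrite -scalerDl -scalerAl mul1r scalerA; congr (_ *: _).
  by rewrite /w; field.
(* Hence [kerR] takes its second branch on [w]. *)
have w1 : w != 1.
  apply/eqP => w1; have /eqP : z + 0 = z - 1.
    by rewrite addr0 -[RHS]mul1r -{1}w1 /w divfK.
  by rewrite (inj_eq (addrI z)) eq_sym oppr_eq0 oner_eq0.
apply: nu_bilin => m n mN nN _ _.
rewrite scaleN1r opprK.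
have kL k a c : z ^+ k *: iv a * c = z%:A ^+ k * (iv a * c).
  by rewrite algX mulr_algl scalerAl.
have kR k a b c : w ^+ k *: (ratio iv b a * nv A a) * c
   = w%:A ^+ k * (ratio iv b a * nv A a) * c.
  by rewrite algX mulr_algl scalerAl.
have -> : \sum_(n <= b < N) kerR iv w n b.+1 * connector x iv m b.+1 =
   \sum_(n <= b < N) w%:A ^+ (b.+1 - n) * (ratio iv n b.+1 * nv A b.+1)
        * connector x iv m b.+1.
  by apply: eq_bigr => b _; rewrite /kerR (negPf w1) kR.
under eq_bigr do rewrite /kerL kL.
rewrite (sum_connector_z ivP (@nvP _ A)) //.
pose B : F := 8 / N.+1%:R.
have sB G m' : (forall a, (a < N)%N -> nu (G a) <= 2 / a.+1%:R * B) ->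
    nu (\sum_(m' <= a < N) G a) <= t * B.
  move=> GB; apply: le_trans (nu_sum _ _ _) _.
  apply: (@le_trans _ _ (\sum_(m' <= a < N) 2 / a.+1%:R * B)).
    rewrite big_nat [leRHS]big_nat; apply: ler_sum => a /andP[_ aN]; exact: GB.
  by rewrite -mulr_suml ler_wpM2r ?divr_ge0.
have xle (c : F) k : `|c| <= 1 -> nu (c%:A ^+ k) <= 1.
  by move=> c1; rewrite algX; apply: nu_scale_le; rewrite ?nu1 // normrX exprn_ile1.
(* The constant 24 is [(2 + 1) * 8]: one far edge carries an extra [ratio], bounded by 2, and 8
   comes from the connector. *)
apply: (@le_trans _ _ (1 * 2 * (t * B) + 1 * (t * B))); last first.
  by rewrite le_eqVlt; apply/orP; left; apply/eqP; rewrite /B; ring.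
apply: le_trans (nuD _ _) _; apply: lerD; apply: nuM_le.
- by apply: nuM_le; rewrite ?xle // nu_ratio // leq_addl.
- apply: sB => a aN; rewrite -[leRHS]mul1r; apply: nuM_le; first exact: xle.
  apply: nuM_le; first by rewrite nu_iv_le //= (leq_trans aN) ?leq_addl.
  by rewrite connectorC; apply: nu_connector.
- exact: xle.
- apply: sB => b bN; apply: nuM_le; last exact: nu_connector.
  rewrite -[leRHS]mul1r; apply: nuM_le; first exact: xle.
  by apply: nuM_le; rewrite ?nu_nv // nu_ratio // (leq_trans bN) ?leq_addl.
Qed.

(** [u] collects the duals of the letters already moved. [size v + size u] is constant and signs
    have modulus 1, so every move costs the same and the errors add up. The side conditions ensure
    vanishing at 0: [None] is never applied to the empty word, nor [Some 1] moved against an empty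
    [u]. *)
Lemma word_transport v u : all (@good_letter F) v -> all bounded_letter u ->
  last (Some 0) v != None -> ohead v != Some (Some 1) \/ u != [::] ->
  nu (connected_sum x iv N (wordL iv v) (wordR iv u)
      - (\prod_(l <- v) sgn_letter l)
          *: connected_sum x iv N (wordL iv [::]) (wordR iv (catrev (map (@dual_letter F) v) u)))
    <= (24 * size v)%:R * t ^+ (size v + size u) / N.+1%:R.
Proof.
elim: v u => [|l v IH] u /=.
  by move=> _ _ _ _; rewrite big_nil scale1r subrr nu0 muln0 !mul0r.
move=> /andP[gl gv] bu lastv hd; rewrite big_cons.
have bv : all bounded_letter v.
  apply: sub_all gv => -[z|] //= /orP[/eqP->|/andP[]//]; by rewrite normr1.
have bdl : bounded_letter (dual_letter l).
  case: l gl {lastv hd} => [z|] /=; last by rewrite normr1.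
  by case: eqP => //= _ /andP[].
have := IH (dual_letter l :: u) gv; rewrite /= bdl bu => /(_ isT).
move=> {}IH; have {}IH := IH _ (or_intror isT).
set Z := connected_sum x iv N (wordL iv [::]) _ in IH *.
rewrite -[X in nu X](subrKA (sgn_letter l *: connected_sum x iv N (wordL iv v)
  (wordR iv (dual_letter l :: u)))).
apply: le_trans (nuD _ _) _.
have lastv' : last (Some 0) v != None by case: (v) lastv.
have tr : nu (connected_sum x iv N (letter_opL iv l (wordL iv v)) (wordR iv u) -
      sgn_letter l *: connected_sum x iv N (wordL iv v) (wordR iv (dual_letter l :: u)))
   <= 24 * t / N.+1%:R * (t ^+ size v * t ^+ size u).
  apply: le_trans (connected_sum_transport gl _ _) _.
  - by move=> l1; case: hd; [rewrite l1 eqxx | case: (u) => // *; exact: wordR0].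
  - by move=> l0; case: (v) lastv => [|l' v' _]; [rewrite l0 | exact: wordL0].
  - rewrite ler_wpM2l ?divr_ge0 ?mulr_ge0 // ?(ltW t_gt0) //.
    by apply: ler_pM; rewrite ?mass_ge0 ?mass_wordL ?mass_wordR.
apply: le_trans (lerD tr _) _.
  rewrite -scalerA -scalerBr nuZ; apply: (@le_trans _ _ (1 * _)).
    apply: ler_pM (IH lastv') => //.
    by case: (l) => [z|] /=; rewrite ?fun_if ?normrN ?normr1 ?if_same.
  exact: lexx.
rewrite mul1r addnS addSn !exprS exprD mulnS natrD.
by rewrite le_eqVlt; apply/orP; left; apply/eqP; ring.
Qed.
End Norm.

(** * Truncated power series *)

Lemma sum_triangle_le (V : nmodType) (G : nat -> nat -> V) n :
  \sum_(0 <= c < n) \sum_(0 <= j < c.+1) G j c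
  = \sum_(0 <= j < n) \sum_(j <= c < n) G j c.
Proof.
elim: n => [|n IH]; first by rewrite !(big_geq (leqnn 0)).
rewrite big_nat_recr //= IH (@big_nat_recr _ _ _ n) //= addrA.
rewrite [RHS]big_nat_recr //= big_nat1; congr (_ + _).
rewrite -big_split /=; apply: eq_big_nat => j /andP[_ jn].
by rewrite big_nat_recr //= ltnW.
Qed.

Section TruncatedSeries.
Variables (F : numFieldType) (h : nat).

Definition tps := {poly %/ ('X^(h.+1) : {poly F})}.
HB.instance Definition _ := GRing.ComAlgebra.on tps.

Definition tcoef c (a : tps) : F := (a : {poly F})`_c.

Definition mktps (f : nat -> F) : tps :=
  in_qpoly ('X^(h.+1) : {poly F}) (\poly_(c < h.+1) f c).

Lemma tcoef_mktps f c : (c <= h)%N -> tcoef c (mktps f) = f c.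
Proof.
move=> ch; rewrite /tcoef /mktps /= mk_monic_Xn /= -Pdiv.RingMonic.take_poly_rmodp coef_take_poly.
by rewrite ltnS ch coef_poly ltnS ch.
Qed.

Lemma tps_eqP (a b : tps) : (forall c, (c <= h)%N -> tcoef c a = tcoef c b) -> a = b.
Proof.
move=> ab; apply/val_inj/polyP => c /=.
have [ch|hc] := leqP c h; first exact: ab.
by rewrite !nth_default // (leq_trans (size_npoly _)) //= mk_monic_Xn /= size_polyXn.
Qed.

Lemma tcoefD c (a b : tps) : tcoef c (a + b) = tcoef c a + tcoef c b.
Proof. by rewrite /tcoef /= coefD. Qed.

Lemma tcoefZ c k (a : tps) : tcoef c (k *: a) = k * tcoef c a.
Proof. by rewrite /tcoef /= coefZ. Qed.

Lemma tcoefN c (a : tps) : tcoef c (- a) = - tcoef c a.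
Proof. by rewrite -scaleN1r tcoefZ mulN1r. Qed.

Lemma tcoefB c (a b : tps) : tcoef c (a - b) = tcoef c a - tcoef c b.
Proof. by rewrite tcoefD tcoefN. Qed.

Lemma tcoef0 c : tcoef c 0 = 0.
Proof. by rewrite /tcoef /= coef0. Qed.

Lemma tcoef1 c : (c <= h)%N -> tcoef c 1 = (c == 0)%:R.
Proof. by move=> ch; rewrite /tcoef /= coefC; case: c ch. Qed.

Lemma tcoef_sum c (I : Type) (r : seq I) (P : pred I) (f : I -> tps) :
  tcoef c (\sum_(i <- r | P i) f i) = \sum_(i <- r | P i) tcoef c (f i).
Proof. exact: (big_morph _ (tcoefD c) (tcoef0 c)). Qed.

Lemma tcoefM c (a b : tps) : (c <= h)%N ->
  tcoef c (a * b) = \sum_(0 <= j < c.+1) tcoef j a * tcoef (c - j) b.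
Proof.
move=> ch; have E (p q : {poly F}) :
    (Pdiv.CommonRing.rmodp (p * q) (mk_monic 'X^(h.+1)))`_c = (p * q)`_c.
  by rewrite mk_monic_Xn -Pdiv.RingMonic.take_poly_rmodp coef_take_poly ltnS ch.
by rewrite /tcoef poly_of_qpolyM E coefM big_mkord.
Qed.

Definition tpsX : tps := mktps (fun c => (c == 1)%:R).

Lemma tcoef_tpsXM c (a : tps) : (c <= h)%N ->
  tcoef c (tpsX * a) = if c is c'.+1 then tcoef c' a else 0.
Proof.
move=> ch; rewrite tcoefM // big_nat (eq_bigr (fun j => (j == 1%N)%:R * tcoef (c - j) a)).
  rewrite -big_nat; case: c ch => [|c] ch; first by rewrite big_nat1 mul0r.
  rewrite big_nat_recl // mul0r add0r big_nat_recl // mul1r subSS subn0 big1 ?addr0 //.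
  by move=> i _; rewrite mul0r.
by move=> j /andP[_ jc]; rewrite tcoef_mktps // (leq_trans _ ch).
Qed.

Lemma tcoef_tpsXnM k c (a : tps) : (c <= h)%N ->
  tcoef c (tpsX ^+ k * a) = if (k <= c)%N then tcoef (c - k) a else 0.
Proof.
elim: k c => [|k IH] c ch; first by rewrite mul1r subn0.
by rewrite exprS -mulrA tcoef_tpsXM //; case: c ch => [|c] ch //; rewrite IH // ltnW.
Qed.

Lemma tpsX_nilp : tpsX ^+ h.+1 = 0.
Proof.
apply: tps_eqP => c ch.
by rewrite -[_ ^+ _]mulr1 tcoef_tpsXnM // ltnNge ch tcoef0.
Qed.

(** The expansion of [1 / (i - X)]: its coefficient of degree [c] raises an exponent by [c], which
    produces the sums [O_h]. *)
Definition tpsiv i : tps := mktps (fun c => i%:R ^- c.+1).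

Lemma tcoef_tpsivM c i (a : tps) : (c <= h)%N ->
  tcoef c (tpsiv i * a) = \sum_(0 <= j < c.+1) i%:R ^- j.+1 * tcoef (c - j) a.
Proof.
move=> ch; rewrite tcoefM // !big_nat; apply: eq_bigr => j /andP[_ jc].
by rewrite tcoef_mktps // (leq_trans _ ch).
Qed.

Lemma tpsivP i : (0 < i)%N -> (i%:R - tpsX) * tpsiv i = 1.
Proof.
move=> i0; have i1 : i%:R != 0 :> F by rewrite pnatr_eq0 -lt0n.
apply: tps_eqP => c ch; rewrite mulrBl tcoefB tcoef1 // tcoef_tpsXM //.
rewrite mulr_natl -(scaler_nat i (tpsiv i)) tcoefZ tcoef_mktps //.
case: c ch => [|c] ch; first by rewrite expr1 divff // subr0.
by rewrite tcoef_mktps ?(ltnW ch) // (exprS _ c.+1) invfM mulrA divff // mul1r subrr.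
Qed.

Variable t : F.
Hypothesis t_gt0 : 0 < t.

(* Taking t of the order of log N keeps the norms of all products of at most 2 N
   factors 1 - x / i and of their inverses bounded uniformly in N. *)
Definition tnorm (a : tps) : F := \sum_(0 <= c < h.+1) `|tcoef c a| * t ^- c.

Let tX_ge0 c : 0 <= t ^- c.
Proof. by rewrite invr_ge0 exprn_ge0 // ltW. Qed.

Lemma tnorm_ge0 a : 0 <= tnorm a.
Proof. by apply: sumr_ge0 => c _; rewrite mulr_ge0. Qed.

Lemma tcoef_le_tnorm c a : (c <= h)%N -> `|tcoef c a| <= t ^+ c * tnorm a.
Proof.
move=> ch; rewrite mulrC -ler_pdivrMr ?exprn_gt0 // /tnorm (@big_cat_nat _ _ _ c) //=.
  rewrite [X in _ + X]big_ltn // addrCA lerDl addr_ge0 //.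
    by apply: sumr_ge0 => j _; rewrite mulr_ge0.
  by apply: sumr_ge0 => j _; rewrite mulr_ge0.
exact: leqW.
Qed.

Lemma tnormD a b : tnorm (a + b) <= tnorm a + tnorm b.
Proof.
rewrite -big_split /=; apply: ler_sum => c _.
by rewrite tcoefD -mulrDl ler_wpM2r // ler_normD.
Qed.

Lemma tnormZ k a : tnorm (k *: a) = `|k| * tnorm a.
Proof. by rewrite mulr_sumr; apply: eq_bigr => c _; rewrite tcoefZ normrM mulrA. Qed.

Lemma tnorm1 : tnorm 1 = 1.
Proof.
rewrite /tnorm big_nat_recl // tcoef1 // normr1 expr0 invr1 mulr1.
rewrite big_nat big1 ?addr0 // => c /andP[_ ch]; by rewrite tcoef1 // normr0 mul0r.
Qed.

(** The weights [t ^- c] are multiplicative in [c], and truncation only drops nonnegative terms of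
    the Cauchy product. *)
Lemma tnormM a b : tnorm (a * b) <= tnorm a * tnorm b.
Proof.
pose G j c := `|tcoef j a| * t ^- j * (`|tcoef (c - j) b| * t ^- (c - j)).
apply: (@le_trans _ _ (\sum_(0 <= c < h.+1) \sum_(0 <= j < c.+1) G j c)).
  rewrite /tnorm big_nat [leRHS]big_nat; apply: ler_sum => c /= ch.
  rewrite tcoefM //; apply: le_trans (_ : (\sum_(0 <= j < c.+1) `|tcoef j a * tcoef (c - j) b|)
     * t ^- c <= _); first by rewrite ler_wpM2r // ler_norm_sum.
  rewrite mulr_suml [leLHS]big_nat [leRHS]big_nat; apply: ler_sum => j /andP[_ jc].
  have -> : t ^- c = t ^- j * t ^- (c - j) by rewrite -invfM -exprD subnKC.
  rewrite normrM /G.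
  by rewrite le_eqVlt; apply/orP; left; apply/eqP; ring.
rewrite sum_triangle_le mulr_suml; apply: ler_sum => j _.
rewrite -mulr_sumr ler_wpM2l ?mulr_ge0 //.
rewrite -{1}[j]add0n big_addn.
rewrite [leRHS](@big_cat_nat _ _ _ (h.+1 - j)) ?leq_subr //= -[leLHS]addr0 lerD //.
  by under eq_bigr do rewrite addnK.
by apply: sumr_ge0 => k _; rewrite mulr_ge0.
Qed.

Lemma tnorm_sub i : (0 < i)%N -> tnorm (i%:R - tpsX) <= i%:R * (1 + 2 / (t * i%:R)).
Proof.
move=> i0; have i1 : i%:R != 0 :> F by rewrite pnatr_eq0 -lt0n.
apply: le_trans (tnormD _ _) _; rewrite mulrDr mulr1; apply: lerD.
  by rewrite -(scaler_nat i (1 : tps)) tnormZ tnorm1 mulr1 normr_nat.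
rewrite -scaleN1r tnormZ normrN1 mul1r.
apply: (@le_trans _ _ t^-1); last first.
  have -> : i%:R * (2 / (t * i%:R)) = 2 / t :> F by field; rewrite i1 gt_eqF.
  by rewrite -[leLHS]mul1r ler_wpM2r ?ler1n // invr_ge0 ltW.
have -> : tnorm tpsX = \sum_(0 <= c < h.+1) (c == 1)%:R * t ^- c.
  rewrite /tnorm big_nat [RHS]big_nat; apply: eq_bigr => c /= ch.
  by rewrite tcoef_mktps // normr_nat.
rewrite big_nat_recl // mul0r add0r.
case: (h) => [|h']; first by rewrite big_geq // invr_ge0 ltW.
rewrite big_nat_recl //= mul1r expr1 big1 ?addr0 // => c _.
by rewrite mul0r.
Qed.

(** Up to the factor [1 / i] the norm is a truncated geometric series in [q = 1 / (t * i) <= 1 / 2],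
    at most [1 + 2 * q]. *)
Lemma tnorm_iv i : (0 < i)%N -> 2 <= t ->
  tnorm (tpsiv i) <= i%:R^-1 * (1 + 2 / (t * i%:R)).
Proof.
move=> i0 t2; have i1 : 0 < i%:R :> F by rewrite ltr0n.
pose q : F := (t * i%:R)^-1.
have q0 : 0 <= q by rewrite invr_ge0 mulr_ge0 // ltW.
have q2 : q <= 2^-1.
  rewrite lef_pV2 ?posrE ?mulr_gt0 //; apply: le_trans t2 _.
  by rewrite -[leLHS]mulr1 ler_pM2l // ler1n.
have geom n : \sum_(0 <= c < n) q ^+ c <= 1 + 2 * q.
  elim: n => [|n IH]; first by rewrite big_geq // addr_ge0 ?mulr_ge0.
  rewrite big_nat_recl // expr0 lerD2l.
  under eq_bigr do rewrite exprS.
  rewrite -mulr_sumr mulrC; apply: (@le_trans _ _ ((1 + 2 * q) * q)).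
    by rewrite ler_wpM2r.
  rewrite ler_wpM2r //; apply: le_trans (_ : 1 + 2 * 2^-1 <= 2).
    by rewrite lerD2l ler_pM2l.
  by rewrite divff ?pnatr_eq0.
apply: le_trans (_ : i%:R^-1 * (\sum_(0 <= c < h.+1) q ^+ c) <= _); last first.
  by rewrite ler_wpM2l // ?invr_ge0 ?ltW.
rewrite le_eqVlt; apply/orP; left; apply/eqP.
rewrite /tnorm mulr_sumr big_nat [RHS]big_nat; apply: eq_bigr => c /= ch.
rewrite tcoef_mktps // ger0_norm ?invr_ge0 ?exprn_ge0 // /q exprVn exprMn exprS !invfM.
by ring.
Qed.

End TruncatedSeries.

(** * Nested sums *)

Section TupleSums.
Variable V : nmodType.

(** [P] and [G] see only the underlying sequence of naturals, so recursion on the length meets no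
    dependent types. *)
Definition tuple_sum n B (P : pred (seq nat)) (G : seq nat -> V) : V :=
  \sum_(t : n.-tuple 'I_B | P [seq val j | j <- t]) G [seq val j | j <- t].

Lemma tuple_sum0 B P G : tuple_sum 0 B P G = if P [::] then G [::] else 0.
Proof.
rewrite /tuple_sum big_mkcond (big_pred1 [tuple of [::]]) //= => t.
by apply/esym/eqP; rewrite (tuple0 t); exact: val_inj.
Qed.

Lemma tuple_sumS n B P G : tuple_sum n.+1 B P G =
  \sum_(0 <= a < B) tuple_sum n B (P \o cons a) (G \o cons a).
Proof.
rewrite /tuple_sum big_mkord.
rewrite (reindex (fun xt : 'I_B * n.-tuple 'I_B => [tuple of xt.1 :: xt.2])) /=.
  rewrite (eq_bigr (fun a : 'I_B => \sum_(t : n.-tuple 'I_B)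
    if P (val a :: [seq val j | j <- t]) then G (val a :: [seq val j | j <- t]) else 0)).
    by rewrite pair_big big_mkcond.
  by move=> a _; rewrite big_mkcond.
exists (fun t => (thead t, [tuple of behead t])) => [[a t]|t] _ /=.
  by congr pair; apply/val_inj.
by apply/val_inj => /=; case: t => -[|a s].
Qed.

Lemma eq_tuple_sum n B P P' G G' : P =1 P' -> G =1 G' ->
  tuple_sum n B P G = tuple_sum n B P' G'.
Proof. by move=> PP GG; apply: eq_big => t; rewrite ?PP ?GG. Qed.

(** The sum over the weak compositions of [h] into [n] parts. *)
Fixpoint compsum (h n : nat) (G : seq nat -> V) : V :=
  if n is n'.+1 then \sum_(0 <= c < h.+1) compsum (h - c)%N n' (G \o cons c)
  else if h == 0%N then G [::] else 0.

Lemma eq_compsum h n G G' : (forall s, size s = n -> G s = G' s) ->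
  compsum h n G = compsum h n G'.
Proof.
elim: n h G G' => [|n IH] h G G' GG /=; first by rewrite GG.
by apply: eq_bigr => c _; apply: IH => s sn /=; rewrite GG //= sn.
Qed.

Lemma tuple_sum_compsum n B h G : (h < B)%N ->
  tuple_sum n B (fun s => sumn s == h) G = compsum h n G.
Proof.
elim: n h G => [|n IH] h G hB /=; first by rewrite tuple_sum0 eq_sym.
rewrite tuple_sumS (@big_cat_nat _ _ _ h.+1) //= [X in _ + X]big_nat_cond.
rewrite [X in _ + X]big1 ?addr0.
  rewrite !big_nat; apply: eq_bigr => c /andP[_ ch].
  rewrite -IH; last by apply: leq_ltn_trans hB; rewrite leq_subr.
  by apply: eq_tuple_sum => // s /=; rewrite -(eqn_add2l c (sumn s)) subnKC.
move=> c /andP[/andP[hc _] _]; rewrite /tuple_sum big_pred0 // => t /=.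
by apply/eqP => E; move: hc; rewrite ltnNge -E leq_addr.
Qed.

Lemma sum_tuple_compsum n B h (G : seq nat -> V) : (h < B)%N ->
  \sum_(c : n.-tuple 'I_B | (\sum_(i < n) val (tnth c i))%N == h)
     G [seq val j | j <- c] = compsum h n G.
Proof.
move=> hB; rewrite -(tuple_sum_compsum _ _ hB); apply: eq_bigl => c.
by rewrite sumnE big_map big_tuple.
Qed.

Lemma compsum_sum h n (I : Type) (r : seq I) (G : I -> seq nat -> V) :
  compsum h n (fun s => \sum_(i <- r) G i s) = \sum_(i <- r) compsum h n (G i).
Proof.
elim: n h G => [|n IH] h G /=; first by case: eqP => // _; rewrite big1.
rewrite exchange_big; apply: eq_bigr => c _; exact: IH.
Qed.

End TupleSums.

Lemma compsum_morph (V V' : nmodType) (f : V -> V') h n (G : seq nat -> V) :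
  f 0 = 0 -> {morph f : a b / a + b} ->
  f (compsum h n G) = compsum h n (f \o G).
Proof.
move=> f0 fD; elim: n h G => [|n IH] h G /=; first by case: eqP.
by rewrite (big_morph f fD f0); apply: eq_bigr => c _; rewrite IH.
Qed.

(** * Truncated series as nested and kernel sums *)

Section Truncations.
Variable F : numFieldType.
Implicit Type p : seq (F * nat).

(** [m] is the previous summation variable and [a.+1] the current one, which therefore ranges over
    [m < a.+1 <= N]. *)
Fixpoint nested_sum p m N : F :=
  if p is (z, k) :: p' then
    \sum_(m <= a < N) z ^+ (a.+1 - m) / a.+1%:R ^+ k * nested_sum p' a.+1 N
  else 1.

Lemma Lish_truncE p N : Lish_trunc p N = nested_sum p 0 N.
Proof.
pose W p m (s : seq nat) : F := \prod_(i < size p)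
  ((nth (0, 0%N) p i).1 ^+ (nth 0%N s i - nth 0%N (m :: s) i)
     / (nth 0%N s i)%:R ^+ (nth (0, 0%N) p i).2).
suff gen m : tuple_sum (size p) N.+1 (path ltn m) (W p m) = nested_sum p m N.
  rewrite -gen /tuple_sum /Lish_trunc; apply: eq_bigr => t _.
  apply: eq_bigr => i _.
  by rewrite (tnth_nth ord0) -(nth_map ord0 0%N) // size_tuple.
elim: p m => [|[z k] p IH] m /=; first by rewrite tuple_sum0 /= /W big_ord0.
rewrite tuple_sumS.
have E a : tuple_sum (size p) N.+1 (path ltn m \o cons a) (W ((z, k) :: p) m \o cons a)
    = if (m < a)%N then z ^+ (a - m) / a%:R ^+ k * nested_sum p a N else 0.
  rewrite -IH /tuple_sum /=; case: ifP => ma /=; last by rewrite big_pred0.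
  by rewrite mulr_sumr; apply: eq_bigr => t _; rewrite /W big_ord_recl.
rewrite (eq_bigr _ (fun a _ => E a)).
rewrite big_nat_recl // ltn0 add0r -big_mkcond.
have [mN|Nm] := leqP m N; last first.
  rewrite [RHS]big_geq; last exact: ltnW.
  rewrite big_nat_cond big_pred0 // => a.
  by apply/negP => /andP[/= aN]; lia.
rewrite (@big_cat_nat _ _ _ m) //= big_nat_cond big_pred0 ?add0r; last first.
  by move=> a; apply/negP => /andP[/= am]; lia.
by rewrite big_nat_cond [RHS]big_nat; apply: eq_bigl => a; rewrite ltnS andbAC andbb.
Qed.

Lemma OsumE h p : Osum h p = compsum h (size p) (fun c => Lish (add_exponents p c)).
Proof. exact: sum_tuple_compsum. Qed.

Definition word p : seq (option F) :=
  flatten [seq Some c.1 :: nseq c.2.-1 None | c <- p].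

Section Algebra.
Variables (A : comAlgType F) (ker : F -> nat -> nat -> A).

Fixpoint kernel_sum p m N : A :=
  if p is (z, k) :: p' then
    \sum_(m <= a < N) ker z m a.+1 * nv A a.+1 ^+ k.-1 * kernel_sum p' a.+1 N
  else 1.

(** Words act letter by letter from the inside, kernel sums column by column; an arbitrary starting
    function [f] carries the induction over columns. *)
Lemma sum_kernel_sum p N (f : nat -> A) :
  \sum_(0 <= a < N.+1) foldl (fun f l => letter_op ker l f) f (word p) a
  = \sum_(0 <= m < N.+1) f m * kernel_sum p m N.
Proof.
elim: p f => [|[z k] p IH] f /=; first by apply: eq_bigr => a _; rewrite mulr1.
rewrite foldl_cat IH.
have nvX n g a : foldl (fun f l => letter_op ker l f) g (nseq n None) a = nv A a ^+ n * g a.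
  elim: n g => [|n IHn] g /=; first by rewrite mul1r.
  by rewrite IHn /= exprSr mulrA.
rewrite /= -/(word p).
under eq_bigr do rewrite nvX /= /integ mulr_sumr mulr_suml.
rewrite sum_triangle; apply: eq_bigr => m _.
by rewrite mulr_sumr; apply: eq_bigr => a _; ring.
Qed.

Lemma sum_foldr_kernel_sum p N :
  \sum_(0 <= a < N.+1) foldr (letter_op ker) (fun m => (m == 0)%:R) (rev (word p)) a
  = kernel_sum p 0 N.
Proof.
have -> (f : nat -> A) : foldr (letter_op ker) f (rev (word p))
    = foldl (fun f l => letter_op ker l f) f (word p).
  by rewrite -[in RHS](revK (word p)) foldl_rev.
rewrite sum_kernel_sum big_nat_recl //= mul1r big1 ?addr0 //.
by move=> i _; rewrite mul0r.
Qed.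

End Algebra.

(** The degree [j] part of [1 / (a - x)] is [a ^- j.+1], which together with the [k - 1] divisions
    gives the exponent [k + j]. *)
Lemma tcoef_kernel_sum h p m N c : is_index (unzip2 p) -> (c <= h)%N ->
  tcoef c (kernel_sum (kerL (tpsiv F h)) p m N)
  = compsum c (size p) (fun e => nested_sum (add_exponents p e) m N).
Proof.
elim: p m c => [|[z k] p IH] m c /=; first by move=> _ ch; rewrite tcoef1 //; case: eqP.
move=> /andP[k0 pi] ch; rewrite tcoef_sum.
transitivity (\sum_(m <= a < N) \sum_(0 <= j < c.+1)
   compsum (c - j)%N (size p) (fun e => z ^+ (a.+1 - m) / a.+1%:R ^+ (k + j)
      * nested_sum (add_exponents p e) a.+1 N)).
  apply: eq_bigr => a _; rewrite /kerL -!scalerAl tcoefZ -mulrA tcoef_tpsivM // mulr_sumr.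
  rewrite big_nat [RHS]big_nat; apply: eq_bigr => j /andP[_ jc].
  rewrite /nv algX mulr_algl tcoefZ IH //; last by rewrite (leq_trans (leq_subr _ _)).
  rewrite !mulrA (compsum_morph (f := *%R _)) ?mulr0 //; last by move=> u v; rewrite mulrDr.
  apply: eq_compsum => e _ /=; congr (_ * _).
  by rewrite -mulrA exprVn -invfM -exprD addSnnS prednK // addnC.
rewrite exchange_big /=; apply: eq_bigr => j _.
by rewrite -compsum_sum.
Qed.
End Truncations.

(** * Generating series of the expansions of a pair *)

Section Expansion.
Variables (F : numFieldType) (h N : nat).
Implicit Type q : seq (F * nat).
Local Notation A := (tps F h).
Local Notation x := (tpsX F h).
Local Notation iv := (tpsiv F h).
Local Notation LL := (kernel_sum (kerL iv)).

Definition expand_gen d (G : seq nat -> A) : A :=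
  \sum_(0 <= i < h.+1) x ^+ i * compsum i d G.

Lemma expand_gen_sum d (I : Type) (r : seq I) (G : I -> seq nat -> A) :
  expand_gen d (fun s => \sum_(i <- r) G i s) = \sum_(i <- r) expand_gen d (G i).
Proof.
rewrite /expand_gen exchange_big; apply: eq_bigr => i _.
by rewrite compsum_sum mulr_sumr.
Qed.

Lemma expand_genM d c (G : seq nat -> A) : expand_gen d (fun s => c * G s)
  = c * expand_gen d G.
Proof.
rewrite /expand_gen mulr_sumr; apply: eq_bigr => i _.
rewrite mulrCA (compsum_morph (f := *%R c)) ?mulr0 //.
by move=> u v; rewrite mulrDr.
Qed.

Lemma expand_genS d (G : seq nat -> A) :
  expand_gen d.+1 G = \sum_(0 <= b < h.+1) x ^+ b * expand_gen d (G \o cons b).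
Proof.
rewrite /expand_gen /=.
under eq_bigr do rewrite mulr_sumr.
rewrite sum_triangle_le; apply: eq_big_nat => b /andP[_ bh].
rewrite mulr_sumr [RHS](@big_cat_nat _ _ _ (h.+1 - b)) ?leq_subr //=.
rewrite [X in _ = _ + X]big_nat_cond [X in _ = _ + X]big1 ?addr0.
  rewrite -{1}[b]add0n big_addn; apply: eq_bigr => i _.
  by rewrite addnK addnC exprD -mulrA.
(* Here [b + i > h], and [x ^+ h.+1 = 0]. *)
move=> i /andP[/andP[hi _] _]; rewrite mulrA -exprD.
by rewrite -(subnKC (_ : (h.+1 <= b + i)%N)) -?leq_subLR // exprD tpsX_nilp !mul0r.
Qed.

Definition pair_ne1 q := num_ne1 (unzip1 q).


(* Both sides satisfy the same first-order recurrence downwards in m, because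
   1 + x / (m - x) = m / (m - x). *)
Lemma kerR_resolvent w l (y g : nat -> A) : w != 1 ->
  (forall m, y m = \sum_(m <= a < N)
     kerL iv w m a.+1 * (nv A a.+1 ^+ l * g a.+1 + x * y a.+1)) ->
  forall m, y m = \sum_(m <= a < N) kerR iv w m a.+1 * nv A a.+1 ^+ l * g a.+1.
Proof.
move=> w1 yE m.
have [|Nm] := leqP m N; last by rewrite yE !big_geq // ltnW.
(* Downward induction on [m], written as [N - n]. *)
move=> mN; rewrite -(subKn mN); move: (N - m)%N (leq_subr m N) => n {m mN}.
elim: n => [|n IH] nN; first by rewrite yE subn0 !big_geq.
have {IH} := IH (ltnW nN).
have -> : (N - n = (N - n.+1).+1)%N by rewrite subnSK.
have : (N - n.+1 < N)%N by lia.
move: (N - n.+1)%N => m mN IH.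
have tail (f : nat -> A) :
    \sum_(m.+1 <= a < N) w ^+ (a.+1 - m) *: f a
    = w *: \sum_(m.+1 <= a < N) w ^+ (a.+1 - m.+1) *: f a.
  rewrite scaler_sumr; apply: eq_big_nat => a /andP[ma _].
  by rewrite scalerA -exprS -subSn // ltnW.
have ivm : 1 + x * iv m.+1 = m.+1%:R * iv m.+1.
  by rewrite -[X in X + _](tpsivP F h (ltn0Sn m)) mulrBl subrK.
have nvm : m.+1%:R * nv A m.+1 = 1 by exact: nvP.
(* The tail of the sum for [y m] is [w] times [y m.+1]; joined with the [x * y] part of the first
   term it carries the factor [1 + x / (m + 1 - x)]. *)
have L1 : y m = w *: (iv m.+1 * (nv A m.+1 ^+ l * g m.+1)
    + m.+1%:R * iv m.+1 * y m.+1).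
  rewrite yE big_ltn // /kerL subSnn expr1.
  under eq_bigr do rewrite -scalerAl.
  rewrite tail (_ : \sum_(m.+1 <= a < N) _ = y m.+1).
    by rewrite -ivm -scalerAl -scalerDr; congr (_ *: _); ring.
  by rewrite yE; apply: eq_bigr => a _; rewrite /kerL -scalerAl.
rewrite L1 big_ltn // IH /kerR (negPf w1) subSnn expr1.
under [in RHS]eq_bigr do rewrite -!scalerAl.
rewrite tail -!scalerAl -scalerDr; congr (_ *: (_ + _)).
  rewrite ratioS // ratio_id mul1r (mulrC (m.+1%:R)) -(mulrA (iv _)) nvm mulr1.
  by rewrite -mulrA.
rewrite mulr_sumr; apply: eq_big_nat => a /andP[ma _].
rewrite -!scalerAl -scalerAr; congr (_ *: _).
by rewrite /ratio [in RHS]big_ltn; [ring | lia].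
Qed.

(** For [w <> 1], let [V b] be the sum with [b] extra columns [(w, 1)]. Removing the first column
    sends [V b.+1] to [V b], so the series of the [x ^+ b * V b] satisfies the equation solved by
    [kerR_resolvent]. *)
Lemma kernel_sum_expand q m : is_index (unzip2 q) ->
  kernel_sum (kerR iv) q m N = expand_gen (pair_ne1 q) (fun b => LL (expand_pair q b) m N).
Proof.
elim: q m => [|[w l] q IH] m /=.
  move=> _; rewrite /expand_gen big_nat_recl //= mul1r big1 ?addr0 // => i _.
  by rewrite mulr0.
move=> /andP[l0 qi]; rewrite /pair_ne1 /= -/(pair_ne1 q).
have [->|w1] := eqVneq w 1.
  rewrite /= add0n -(_ : expand_gen (pair_ne1 q) (fun b => LL ((1, l) :: expand_pair q b) m N)
    = expand_gen (pair_ne1 q) _) //= expand_gen_sum.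
  apply: eq_bigr => a _; rewrite expand_genM IH // /kerR /kerL eqxx expr1n scale1r.
  by [].
rewrite add1n expand_genS /=.
pose V b m := expand_gen (pair_ne1 q) (fun s =>
  LL (nseq b (w, 1%N) ++ (w, l) :: expand_pair q s) m N).
transitivity (\sum_(0 <= b < h.+1) x ^+ b * V b m); last by [].
have V0 m' : V 0%N m' = \sum_(m' <= a < N) kerL iv w m' a.+1 *
    (nv A a.+1 ^+ l.-1 * kernel_sum (kerR iv) q a.+1 N).
  rewrite /V /= expand_gen_sum; apply: eq_bigr => a _.
  by rewrite expand_genM IH // mulrA.
have VS b m' : V b.+1 m' = \sum_(m' <= a < N) kerL iv w m' a.+1 * V b a.+1.
  rewrite /V /= expand_gen_sum; apply: eq_bigr => a _.
  by rewrite expand_genM expr0 mulr1.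
apply/esym.
apply: (@kerR_resolvent w l.-1 (fun m => \sum_(0 <= b < h.+1) x ^+ b * V b m)
  (fun a => kernel_sum (kerR iv) q a N)) => // m'.
rewrite big_nat_recl // mul1r V0.
under [in RHS]eq_bigr do rewrite mulrDr.
rewrite big_split /=; congr (_ + _).
under eq_bigr do rewrite VS mulr_sumr.
rewrite exchange_big /=; apply: eq_bigr => a _.
(* The top term [b = h] acquires [x ^+ h.+1 = 0], so cutting the series at [h] keeps the equation
   exact. *)
rewrite big_nat_recr //= mulrDr !mulrA -exprS tpsX_nilp mul0r addr0.
rewrite mulr_sumr mulr_sumr; apply: eq_bigr => b _.
by rewrite exprS; ring.
Qed.

Lemma tcoef_kernel_sum_kerR q : is_index (unzip2 q) ->
  tcoef h (kernel_sum (kerR iv) q 0 N) =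
  \sum_(0 <= i < h.+1) compsum i (pair_ne1 q) (fun b =>
    compsum (h - i)%N (size (expand_pair q b)) (fun e =>
      nested_sum (add_exponents (expand_pair q b) e) 0 N)).
Proof.
move=> qi; rewrite kernel_sum_expand // tcoef_sum.
apply: eq_big_nat => i /andP[_ ih]; rewrite tcoef_tpsXnM // -ltnS ih.
rewrite (compsum_morph (f := @tcoef F h (h - i)%N)) ?tcoef0 //; last exact: tcoefD.
apply: eq_compsum => b _ /=; rewrite tcoef_kernel_sum ?leq_subr //.
elim: q b qi {ih} => [|[w l] q IH] b //= /andP[l0 qi].
case: ifP => _ /=; rewrite ?l0 ?IH //.
by rewrite /unzip2 map_cat /is_index all_cat map_nseq all_nseq orbT /= l0; exact: IH.
Qed.

End Expansion.

(** * Convergence *)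

Section AbsoluteBounds.
Variable F : numFieldType.
Implicit Type p : seq (F * nat).

Definition abs_pair p : seq (F * nat) := [seq (`|c.1|, c.2) | c <- p].

Lemma nested_sum_abs_ge0 p m N : 0 <= nested_sum (abs_pair p) m N.
Proof.
elim: p m => [|[z k] p IH] m //=; apply: sumr_ge0 => a _.
by rewrite mulr_ge0 // divr_ge0 ?exprn_ge0.
Qed.

Lemma nested_sum_norm_le p m N : `|nested_sum p m N| <= nested_sum (abs_pair p) m N.
Proof.
elim: p m => [|[z k] p IH] m /=; first by rewrite normr1.
apply: le_trans (ler_norm_sum _ _ _) _; apply: ler_sum => a _.
by rewrite !normrM normfV !normrX normr_nat ler_wpM2l // divr_ge0 ?exprn_ge0.
Qed.

(** Increments are dominated by those of a nondecreasing sequence, so convergence reduces to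
    bounding the sums of absolute values. *)
Lemma nested_sum_step_le p m N :
  `|nested_sum p m N.+1 - nested_sum p m N|
    <= nested_sum (abs_pair p) m N.+1 - nested_sum (abs_pair p) m N.
Proof.
elim: p m => [|[z k] p IH] m /=; first by rewrite !subrr normr0.
have [mN|Nm] := leqP m N; last by rewrite !big_geq ?subrr ?normr0 // ltnW.
rewrite !big_nat_recr //= addrAC -sumrB [leRHS]addrAC -sumrB.
apply: le_trans (ler_normD _ _) _; apply: lerD; last first.
  rewrite !normrM normfV !normrX normr_nat ler_wpM2l ?divr_ge0 ?exprn_ge0 //.
  exact: nested_sum_norm_le.
apply: le_trans (ler_norm_sum _ _ _) _; apply: ler_sum => a _.
by rewrite -!mulrBr !normrM normfV !normrX normr_nat ler_wpM2l // divr_ge0 ?exprn_ge0.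
Qed.

Definition good_pair p :=
  all (fun c => (`|c.1| <= 1) && (0 < c.2)%N) p
  && (((1 < (last (0%R, 2%N) p).2)%N) || (`|(last (0%R, 2%N) p).1| < 1)).

Lemma sum_telescope_inv_le m N :
  \sum_(m <= a < N) (a.+1%:R * a.+2%:R)^-1 <= m.+1%:R^-1 :> F.
Proof.
have [mN|Nm] := leqP m N; last by rewrite big_geq ?invr_ge0 // ltnW.
rewrite (eq_bigr (fun a => - (a.+2%:R^-1 - a.+1%:R^-1))); last first.
  move=> a _; have a1 : a.+1%:R != 0 :> F by rewrite pnatr_eq0.
  have a2 : a.+1%:R + 1 != 0 :> F by rewrite natr1 pnatr_eq0.
  by rewrite -[a.+2%:R]natr1; move: (a.+1%:R) a1 a2 => y y0 y1; field; rewrite y0.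
by rewrite sumrN (telescope_sumr (fun a => a.+1%:R^-1)) // opprB gerBl invr_ge0.
Qed.

(** The decay in [m] makes the induction close: one more column gives the sum of
    [C / ((a + 1) * (a + 2))], which telescopes to at most [C / (m + 1)]. *)
Lemma nested_sum_abs_bound p : p <> [::] -> good_pair p ->
  exists2 C : F, 0 <= C & forall m N, nested_sum (abs_pair p) m N <= C / m.+1%:R.
Proof.
elim: p => // -[z k] p IH _ /andP[/= /andP[/andP[z1 k0] gp] lp].
have zX j : `|z| ^+ j <= 1 by rewrite exprn_ile1.
case: p IH gp lp => [_ _ /= lp|c p IH gp lp].
  case/orP: lp => [k2|zlt].
    (* From [1 / (a + 1)^2 <= 2 / ((a + 1) * (a + 2))]. *)
    exists 2 => // m N; apply: (@le_trans _ _ (2 * \sum_(m <= a < N) (a.+1%:R * a.+2%:R)^-1)).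
      rewrite mulr_sumr; apply: ler_sum => a _; rewrite mulr1.
      apply: (@le_trans _ _ (1 / a.+1%:R ^+ 2)).
        apply: ler_pM => //; rewrite ?exprn_ge0 ?invr_ge0 ?exprn_ge0 //.
        rewrite lef_pV2 ?posrE ?exprn_gt0 ?ltr0n //.
        by rewrite -!natrX ler_nat leq_pexp2l.
      rewrite expr2 !invfM mul1r mulrCA ler_pM2l ?invr_gt0 ?ltr0n //.
      rewrite ler_pdivlMr ?ltr0n // mulrC ler_pdivrMr ?ltr0n //.
      by rewrite -natrM ler_nat; lia.
    by rewrite ler_pM2l // sum_telescope_inv_le.
  have z10 : 0 < 1 - `|z| by rewrite subr_gt0.
  (* The sum of the geometric series in the modulus of [z], the denominators being at least
     [m + 1]. *)
  exists ((1 - `|z|)^-1); first by rewrite invr_ge0 ltW.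
  move=> m N; apply: (@le_trans _ _ (\sum_(m <= a < N) `|z| ^+ (a - m) / m.+1%:R)).
    rewrite big_nat [leRHS]big_nat; apply: ler_sum => a /andP[ma _]; rewrite mulr1.
    apply: ler_pM; rewrite ?exprn_ge0 ?invr_ge0 ?exprn_ge0 //.
      by rewrite subSn // exprS -[leRHS]mul1r ler_wpM2r // exprn_ge0.
    rewrite lef_pV2 ?posrE ?exprn_gt0 ?ltr0n //.
    rewrite -natrX ler_nat; apply: (@leq_trans a.+1) => //.
    by rewrite -{1}[a.+1]expn1 leq_pexp2l.
  rewrite -mulr_suml ler_wpM2r ?invr_ge0 //.
  rewrite -{1}[m]add0n big_addn; under eq_bigr do rewrite addnK.
  rewrite -[leRHS]mul1r ler_pdivlMr // big_mkord mulrC.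
  by rewrite -opprB mulNr -subrX1 opprB gerBl exprn_ge0.
have {}lp : good_pair (c :: p) by rewrite /good_pair gp.
have [//|C C0 CP] := IH _ lp; exists C => // m N.
apply: (@le_trans _ _ (C * \sum_(m <= a < N) (a.+1%:R * a.+2%:R)^-1)).
  rewrite mulr_sumr [leLHS]/=; apply: ler_sum => a _.
  apply: (@le_trans _ _ (1 / a.+1%:R * (C / a.+2%:R))); last first.
    by rewrite mul1r invfM mulrCA.
  apply: ler_pM; rewrite ?CP ?divr_ge0 ?exprn_ge0 ?(nested_sum_abs_ge0 (c :: p)) //.
  apply: ler_pM => //; rewrite ?exprn_ge0 ?invr_ge0 ?exprn_ge0 //.
  rewrite lef_pV2 ?posrE ?exprn_gt0 ?ltr0n //.
  by rewrite -natrX ler_nat -{1}[a.+1]expn1 leq_pexp2l.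
by rewrite ler_wpM2l // sum_telescope_inv_le.
Qed.
End AbsoluteBounds.

Definition tends (K : numFieldType) (u : nat -> K) (l : K) :=
  forall e, 0 < e -> exists n0, forall n, (n0 <= n)%N -> `|l - u n| < e.

Lemma tends_cvgn (K : numFieldType) (u : nat -> K) (l : K) :
  tends u l -> (u @ \oo --> l)%classic.
Proof.
move=> H; apply/cvgrPdist_lt => e /H[n0 Hn0].
by exists n0 => // n /= n0n; apply: Hn0.
Qed.

(** * Logarithmic growth of harmonic numbers *)

Section RealBounds.
Variable R : realType.

(** That is, [H_n <= 1 + log (n + 1)]. The inductive step uses [exp (- 1 / (n + 2)) >= 1 - 1 / (n +
    2) = (n + 1) / (n + 2)]. *)
Lemma expR_harm n : expR (harm R n) <= expR 1 * n.+1%:R.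
Proof.
case: n => [|n].
  by rewrite /harm big_geq // expR0 mulr1 -expR0 ler_expR.
apply: (@le_trans _ _ (expR 1 * n.+1%:R)); last first.
  by rewrite ler_pM2l ?expR_gt0 // ler_nat.
elim: n => [|n IH]; first by rewrite /harm big_nat1 invr1 mulr1.
rewrite /harm big_nat_recr //= expRD -/(harm R n.+1).
have n2 : 0 < n.+2%:R :> R by rewrite ltr0n.
apply: (@le_trans _ _ (expR 1 * n.+1%:R * (n.+2%:R / n.+1%:R))); last first.
  by rewrite mulrA -(mulrA (expR 1)) (mulrC n.+1%:R) mulrA mulfK // pnatr_eq0.
apply: ler_pM; rewrite ?expR_ge0 //.
rewrite -[leLHS]invrK -[leRHS]invrK lef_pV2 ?posrE ?invr_gt0 ?expR_gt0 ?divr_gt0 ?ltr0n //.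
rewrite invf_div -expRN; apply: le_trans (expR_ge1Dx _).
rewrite le_eqVlt; apply/orP; left; apply/eqP.
have : n.+1%:R + 1 != 0 :> R by rewrite natr1 pnatr_eq0.
by rewrite -[n.+2%:R]natr1; move: (n.+1%:R) => y y1; field.
Qed.

(** With [J = j + 1], take [J]-th roots: [1 + y <= J * (1 + y / J) <= J * exp (y / J)]. *)
Lemma pow1D_le_expR (y : R) j : 0 <= y -> (1 + y) ^+ j.+1 <= j.+1%:R ^+ j.+1 * expR y.
Proof.
move=> y0; have j0 : j.+1%:R != 0 :> R by rewrite pnatr_eq0.
have -> : expR y = expR (y / j.+1%:R) ^+ j.+1.
  by rewrite -expRM_natl mulrC divfK.
rewrite -exprMn; apply: lerXn2r; rewrite ?nnegrE ?addr_ge0 ?mulr_ge0 ?expR_ge0 //.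
apply: (@le_trans _ _ (j.+1%:R * (1 + y / j.+1%:R))).
  by rewrite mulrDr mulr1 mulrCA divff // mulr1 lerD2r ler1n.
by rewrite ler_pM2l ?ltr0n // expR_ge1Dx.
Qed.

(** Squaring the quantity gives two factors [1 / (N + 1)]: one absorbs the power of the harmonic
    number, bounded by a constant times [exp (H_(2N)) <= 2 * e * (N + 1)], and the other tends to
    0. *)
Lemma harm_pow_negligible (D : R) j e : 0 <= D -> 0 < e ->
  exists n0, forall N, (n0 <= N)%N ->
    D * (4 * (1 + harm R (N + N))) ^+ j / N.+1%:R < e.
Proof.
move=> D0 e0; pose J := (j + j).+1.
pose E : R := D ^+ 2 * 16 ^+ j * (J%:R ^+ J * (expR 1 * 2)).
have E0 : 0 <= E by rewrite !mulr_ge0 ?exprn_ge0 ?expR_ge0.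
exists (Num.bound (E / e ^+ 2)) => N nN.
set y := harm R (N + N); have y0 : 0 <= y := harm_ge0 _ _.
have N0 : 0 < N.+1%:R :> R by rewrite ltr0n.
have yJ : (1 + y) ^+ (j + j) <= J%:R ^+ J * (expR 1 * 2) * N.+1%:R.
  apply: (@le_trans _ _ ((1 + y) ^+ J)).
    by rewrite ler_weXn2l ?leqnSn // lerDl.
  apply: le_trans (pow1D_le_expR _ y0) _; rewrite -mulrA ler_wpM2l ?exprn_ge0 //.
  apply: le_trans (expR_harm _) _; rewrite -mulrA ler_pM2l ?expR_gt0 //.
  by rewrite -natrM ler_nat; lia.
rewrite -(@ltr_pXn2r _ 2) ?nnegrE ?(ltW e0) //; last first.
  by rewrite divr_ge0 // mulr_ge0 // exprn_ge0 // mulr_ge0 // addr_ge0.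
apply: (@le_lt_trans _ _ (E / N.+1%:R)).
  have -> : (D * (4 * (1 + y)) ^+ j / N.+1%:R) ^+ 2
     = D ^+ 2 * 16 ^+ j * (1 + y) ^+ (j + j) / N.+1%:R / N.+1%:R.
    have -> : 16 ^+ j = 4 ^+ j * 4 ^+ j :> R by rewrite -exprMn -natrM.
    rewrite exprD [(4 * _) ^+ j]exprMn.
    by move: (4 ^+ j) ((1 + y) ^+ j) => c d; ring.
  rewrite ler_pM2r ?invr_gt0 // ler_pdivrMr // /E -[leRHS]mulrA.
  by rewrite ler_wpM2l // mulr_ge0 ?exprn_ge0.
rewrite ltr_pdivrMr // mulrC -ltr_pdivrMr ?exprn_gt0 //.
apply: lt_le_trans (archi_boundP _) _; first by rewrite divr_ge0 // exprn_ge0 // ltW.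
by rewrite ler_nat ltnW.
Qed.

End RealBounds.

(** * Convergence of dominated complex sequences *)

Section ComplexLimits.
Variable R : realType.
Local Open Scope complex_scope.

Lemma harm_complex n : harm R[i] n = (harm R n)%:C.
Proof. by rewrite rmorph_sum; apply: eq_bigr => i _; rewrite fmorphV rmorph_nat. Qed.

Lemma complex_eps (e : R[i]) : 0 < e -> exists2 r : R, 0 < r & e = r%:C.
Proof.
move=> e0; have er := RRe_real (gtr0_real e0).
by exists (complex.Re e) => //; rewrite -ltcR er.
Qed.

Lemma normcR (r : R) : `|r%:C| = `|r|%:C.
Proof. by rewrite normc_def /= expr0n addr0 sqrtr_sqr. Qed.

Lemma Re_norm_le (z : R[i]) (r : R) : `|z| <= r%:C -> `|complex.Re z| <= r.
Proof. by move=> zr; rewrite -lecR; apply: le_trans (normc_ge_Re z) zr. Qed.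

Lemma Im_norm_le (z : R[i]) (r : R) : `|z| <= r%:C -> `|complex.Im z| <= r.
Proof.
move=> zr; have := @Re_norm_le (z * 'i) r; rewrite normrM ReiNIm normrN.
apply; apply: le_trans zr; rewrite [X in _ * X](_ : _ = 1) ?mulr1 //.
by rewrite normc_def /= expr0n add0r expr1n sqrtr1.
Qed.

(* r + v is nondecreasing and bounded. *)
Lemma real_cvg_dominated (r v : nat -> R) B :
  (forall n, `|r n.+1 - r n| <= v n.+1 - v n) -> (forall n, v n <= B) ->
  exists l, tends r l.
Proof.
move=> rv vB.
have v_nd : {homo v : m n / (m <= n)%N >-> m <= n}.
  apply: homo_leq => // [a b c|n]; first exact: le_trans.
  by rewrite -subr_ge0; apply: le_trans (rv n).
have s_nd : {homo (fun n => r n + v n) : m n / (m <= n)%N >-> m <= n}.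
  apply: homo_leq => // [a b c|n]; first exact: le_trans.
  by have := rv n; rewrite ler_norml => /andP[]; lra.
have rB n : r n + v n <= r 0%N - v 0%N + (B + B).
  apply: (@le_trans _ _ (r 0%N - v 0%N + (v n + v n))); last first.
    by rewrite lerD2l lerD.
  rewrite addrA lerD2r; elim: n => [|n IH]; first by rewrite subrK.
  by have := rv n; rewrite ler_norml => /andP[]; lra.
have cv : cvgn v.
  by apply: nondecreasing_is_cvgn => //; exists B => _ [n _ <-].
have cs : cvgn (fun n => r n + v n).
  by apply: nondecreasing_is_cvgn => //; eexists => _ [n _ <-]; exact: rB.
exists (limn (fun n => r n + v n) - limn v) => e e0.
have : ((fun n => (r n + v n) - v n) @ \oo --> limn (fun n => r n + v n) - limn v)%classic.
  exact: cvgB.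
move=> /cvgrPdist_lt/(_ e e0)[n0 _ H]; exists n0 => n n0n.
by have := H n n0n; rewrite /= addrK.
Qed.

Lemma complex_cvg_dominated (u V : nat -> R[i]) B :
  (forall n, `|u n.+1 - u n| <= V n.+1 - V n) -> (forall n, V n <= B) ->
  exists l, tends u l.
Proof.
move=> uV VB.
(* [V] itself need not be real, but its increments are, as they dominate a norm. *)
have uV' n : `|u n.+1 - u n| <= (complex.Re (V n.+1) - complex.Re (V n))%:C.
  apply: le_trans (uV n) _; rewrite -raddfB /= RRe_real //.
  by rewrite ger0_real // (le_trans _ (uV n)).
have VB' n : complex.Re (V n) <= complex.Re B.
  by have := VB n; rewrite lecE => /andP[].
have [a aP] : exists l, tends (fun n => complex.Re (u n)) l.
  apply: real_cvg_dominated VB' => n; rewrite -raddfB; exact: Re_norm_le.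
have [b bP] : exists l, tends (fun n => complex.Im (u n)) l.
  apply: real_cvg_dominated VB' => n; rewrite -raddfB; exact: Im_norm_le.
exists (a +i* b) => e /complex_eps[r r0 ->].
have r2 : 0 < r / 2 by rewrite divr_gt0.
have [na Ha] := aP _ r2; have [nb Hb] := bP _ r2.
exists (maxn na nb) => n; rewrite geq_max => /andP[/Ha {}Ha /Hb {}Hb].
have -> : a +i* b - u n = (a - complex.Re (u n))%:C + 'i * (b - complex.Im (u n))%:C.
  by case: (u n) => c d; simpc.
apply: le_lt_trans (ler_normD _ _) _; rewrite normrM !normcR.
have -> : `|'i| = 1 :> R[i] by rewrite normc_def /= expr0n add0r expr1n sqrtr1.
by rewrite mul1r -rmorphD /= ltcR [ltRHS]splitr ltrD.
Qed.

End ComplexLimits.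

(** * Duality *)

Section Words.
Variable F : numFieldType.
Implicit Types (p : seq (F * nat)) (v : seq (option F)).

(** On words, duality is the reversal combined with a letterwise involution pattern exchanging
    [None] and [Some 1]; no block decomposition is involved. *)
Definition dual_word v := rev (map (@dual_letter F) v).

Lemma dual_word_cat v u : dual_word (v ++ u) = dual_word u ++ dual_word v.
Proof. by rewrite /dual_word map_cat rev_cat. Qed.

Lemma dual_word_nseq n (l : option F) : dual_word (nseq n l) = nseq n (dual_letter l).
Proof. by rewrite /dual_word map_nseq rev_nseq. Qed.

Lemma word_cat p q : word (p ++ q) = word p ++ word q.
Proof. by rewrite /word map_cat flatten_cat. Qed.

Lemma word_ones1 n : word (ones F (nseq n 1%N)) = nseq n (Some 1).
Proof. by elim: n => //= n IH; rewrite -IH. Qed.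

Lemma word_ones_rcons l k :
  word (ones F (rcons l k)) = word (ones F l) ++ Some 1 :: nseq k.-1 None.
Proof. by rewrite /ones map_rcons -cats1 word_cat {2}/word /= cats0. Qed.

(** The block [({1}^(a - 1), b + 1)] is [a] letters [Some 1] followed by [b] letters [None];
    reversing and dualising it therefore swaps [a] and [b]. *)
Lemma word_index_blocks ab : wf_index_blocks ab ->
  word (ones F (index_of_blocks ab))
  = flatten [seq nseq x.1 (Some 1) ++ nseq x.2 None | x <- ab].
Proof.
elim: ab => [|[a b] ab IH] //= /andP[/andP[/= a0 b0] /IH E].
rewrite /index_of_blocks /= -/(index_of_blocks _) /ones map_cat word_cat -/(ones _ _) E.
rewrite -/(ones F _) word_ones_rcons word_ones1; congr (_ ++ _).
case: a a0 => // a _ /=.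
by rewrite -cat_cons -[_ :: nseq a _]/(nseq a.+1 (Some (1 : F))) -addn1 nseqD -catA.
Qed.

Lemma word_dual_index l : is_index l -> admissible l ->
  word (ones F (dual_index l)) = dual_word (word (ones F l)).
Proof.
move=> il al; have wf := wf_index_blocks_from 0 il.
rewrite -{2}(index_blocksK il al) word_index_blocks //.
rewrite /dual_index word_index_blocks.
  elim: (index_blocks l) => //= -[a b] ab IH.
  rewrite rev_cons map_rcons map_rcons flatten_rcons IH dual_word_cat.
  by rewrite dual_word_cat !dual_word_nseq /= eqxx.
rewrite /wf_index_blocks all_map all_rev; apply: sub_all wf => -[a b] /=.
by rewrite andbC.
Qed.

Lemma word_block_cols (B : block F) : word (block_cols B) =
  word (ones F (block_l B)) ++ nseq (block_a B).-1 (Some 1)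
    ++ Some (block_w B) :: nseq (block_b B).-1 None.
Proof. by rewrite /block_cols !word_cat word_ones1 /word /= cats0. Qed.

Lemma word_dual_block_cols (B : block F) : wf_block B ->
  word (dual_block_cols B) = dual_word (word (block_cols B)).
Proof.
move=> /and5P[il al a0 b0 w1]; rewrite word_block_cols /dual_block_cols.
rewrite word_cat word_ones1 /word /= -/(word _) word_dual_index //.
rewrite -[_ :: nseq _ None]cat1s !dual_word_cat !dual_word_nseq /= eqxx.
by rewrite /dual_word /= (negPf w1) -!catA.
Qed.

Lemma word_dual_assemble (D : seq (block F) * seq nat) : wf_decomp D ->
  word (dual_assemble D) = dual_word (word (assemble D)).
Proof.
case: D => bs l /and3P[/= wb il al].
rewrite /dual_assemble /assemble /= !word_cat dual_word_cat word_dual_index //.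
congr (_ ++ _); elim: bs wb => //= B bs IH /andP[wB /IH E].
rewrite rev_cons map_rcons flatten_rcons word_cat (word_cat (block_cols B)) dual_word_cat E.
by rewrite word_dual_block_cols.
Qed.

Lemma word_dual_pair p : wf_decomp (decompose p) ->
  word (dual_pair p) = dual_word (word p).
Proof. by move=> wf; rewrite /dual_pair word_dual_assemble // decomposeK. Qed.

Lemma is_index_cat s s' : is_index (s ++ s') = is_index s && is_index s'.
Proof. exact: all_cat. Qed.

Lemma is_index_dual l : is_index (dual_index l).
Proof.
rewrite /dual_index; elim: map => //= x ab IH.
by rewrite /index_of_blocks /= is_index_cat IH /is_index all_rcons all_nseq orbT.
Qed.

Lemma unzip2_ones l : unzip2 (ones F l) = l.
Proof. by rewrite /unzip2 /ones -map_comp map_id. Qed.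

Lemma is_index_dual_pair p : wf_decomp (decompose p) -> is_index (unzip2 (dual_pair p)).
Proof.
rewrite /dual_pair; case: (decompose p) => bs l /and3P[/= wb il al].
rewrite /dual_assemble /= /unzip2 map_cat is_index_cat -/(unzip2 _) unzip2_ones.
rewrite is_index_dual /=; elim: bs wb => //= B bs IH /andP[/and5P[Bl _ a0 _ _] /IH E].
rewrite rev_cons map_rcons flatten_rcons map_cat is_index_cat E /=.
rewrite map_cat is_index_cat -/(unzip2 _) unzip2_ones /= a0 -/(unzip2 _) unzip2_ones.
by rewrite is_index_dual /is_index all_nseq orbT.
Qed.

Definition ne1_letter (l : option F) : bool := if l is Some z then z != 1 else false.

Lemma pair_ne1_word p : pair_ne1 p = count ne1_letter (word p).
Proof.
rewrite /pair_ne1 /num_ne1; elim: p => //= -[z k] p IH /=.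
by rewrite count_cat -/(word p) -IH count_nseq /= mul0n add0n.
Qed.

Lemma sgn_word v : \prod_(l <- v) sgn_letter l = (-1) ^+ count ne1_letter v.
Proof.
elim: v => [|l v IH]; first by rewrite big_nil.
rewrite big_cons IH /= exprD; congr (_ * _).
by case: l => //= z; case: eqP.
Qed.

Lemma dual_letter_ne1 l : ne1_letter (dual_letter l) = ne1_letter l.
Proof.
case: l => [z|] /=; last by rewrite eqxx.
have [//|z1 /=] := eqVneq z 1; apply/eqP => w1.
have /eqP : z + 0 = z - 1.
  by rewrite addr0 -[RHS]mul1r -{1}w1 divfK // subr_eq0.
by rewrite (inj_eq (addrI z)) eq_sym oppr_eq0 oner_eq0.
Qed.

Lemma count_dual_word v : count ne1_letter (dual_word v) = count ne1_letter v.
Proof.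
rewrite /dual_word count_rev count_map.
by apply: eq_count => l /=; rewrite dual_letter_ne1.
Qed.

(** The last letter is some [Some w] when the outermost exponent is 1, where convergence needs [w]
    in the open disc; the default [None] accepts the empty word. *)
Definition contractive_last v := if last None v is Some w then `|w| < 1 else true.

Lemma good_pair_word p : is_index (unzip2 p) ->
  all (@bounded_letter F) (word p) -> contractive_last (word p) -> good_pair p.
Proof.
move=> ip bp lp; apply/andP; split.
  elim: p ip bp {lp} => //= -[z k] p IH /andP[k0 ip] /=.
  by rewrite all_cat => /andP[-> /andP[_ bp]]; rewrite k0 IH.
case/lastP: p ip lp {bp} => // p [z k]; rewrite last_rcons /= -cats1.
rewrite /unzip2 map_cat is_index_cat word_cat /contractive_last last_cat /= cats0.
by case: k => [|[|k]] //=; rewrite andbF.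
Qed.

Lemma good_add_exponents p c : size c = size p -> good_pair p ->
  good_pair (add_exponents p c).
Proof.
move=> sc /andP[ap lp]; apply/andP; split.
  elim: p c sc ap {lp} => [|[z k] p IH] [|e c] //= [sc] /andP[/andP[-> k0] ap].
  by rewrite addn_gt0 k0 IH.
case/lastP: p sc lp {ap} => [|p [z k]]; first by case: c.
case/lastP: c => [|c e]; rewrite ?size_rcons // => -[sc].
rewrite /add_exponents zip_rcons // map_rcons !last_rcons /=.
by move=> /orP[k1|->]; rewrite ?orbT // (leq_trans k1) ?leq_addr.
Qed.

Lemma good_expand_pair p b : good_pair p -> good_pair (expand_pair p b).
Proof.
have H : forall p b, all (fun c => (`|c.1| <= 1) && (0 < c.2)%N) p ->
   all (fun c => (`|c.1| <= 1) && (0 < c.2)%N) (expand_pair p b)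
   /\ forall c0, last c0 (expand_pair p b) = last c0 p.
  elim=> // -[z k] q IH c /= /andP[/andP[z1 k0] aq].
  case: ifP => _ /=; first by have [-> lq] := IH c aq; rewrite z1 k0.
  have [aq' lq] := IH (behead c) aq.
  rewrite all_cat all_nseq /= z1 k0 aq' orbT; split=> // c0.
  by rewrite last_cat /= lq.
by move=> /andP[/(H _ b)[ap lp]]; rewrite /good_pair ap lp.
Qed.

Lemma expand_pair_ones l b : expand_pair (ones F l) b = ones F l.
Proof. by elim: l => //= x l ->; rewrite eqxx. Qed.

End Words.

Section Limits.
Variable K : numFieldType.

Lemma tends_unique_scaled (u v : nat -> K) a b s :
  (u @ \oo --> a)%classic -> (v @ \oo --> b)%classic ->
  tends (fun n => u n - s * v n) 0 -> a = s * b.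
Proof.
move=> ua vb /tends_cvgn uv0; apply/eqP; rewrite -subr_eq0; apply/eqP.
apply: (@cvg_unique _ (@norm_hausdorff K K^o) _ _ _ _ _ uv0).
by apply: cvgB => //; apply: cvgM => //; exact: cvg_cst.
Qed.

Lemma cvgn_sum (I : eqType) (r : seq I) (f : I -> nat -> K) (l : I -> K) :
  (forall i, i \in r -> (f i @ \oo --> l i)%classic) ->
  ((fun N => \sum_(i <- r) f i N) @ \oo --> \sum_(i <- r) l i)%classic.
Proof.
elim: r => [|i r IH] fl.
  by rewrite big_nil; under eq_fun do rewrite big_nil; exact: cvg_cst.
rewrite big_cons; under eq_fun do rewrite big_cons.
by apply: cvgD; [apply: fl; rewrite mem_head |
  apply: IH => j jr; apply: fl; rewrite inE jr orbT].
Qed.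

Lemma cvgn_compsum h n (G : nat -> seq nat -> K) L :
  (forall c, size c = n -> ((G ^~ c) @ \oo --> L c)%classic) ->
  ((fun N => compsum h n (G N)) @ \oo --> compsum h n L)%classic.
Proof.
elim: n h G L => [|n IH] h G L GL /=.
  by case: eqP => _; [exact: GL | exact: cvg_cst].
apply: (cvgn_sum (f := fun c N => compsum (h - c)%N n (G N \o cons c))) => c _.
by apply: (IH _ (fun N => G N \o cons c)) => e en; apply: GL; rewrite /= en.
Qed.

Lemma Lish_cvg (p : seq (K * nat)) : (exists l, tends (nested_sum p 0) l) ->
  (nested_sum p 0 @ \oo --> Lish p)%classic.
Proof.
move=> [l /tends_cvgn pl]; have e : Lish_trunc p = nested_sum p 0.
  by apply: funext => N; exact: Lish_truncE.
by rewrite /Lish e; apply/cvg_ex; exists l.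
Qed.

Lemma Osum_cvg h (p : seq (K * nat)) :
  (forall c, size c = size p -> exists l, tends (nested_sum (add_exponents p c) 0) l) ->
  ((fun N => compsum h (size p) (fun c => nested_sum (add_exponents p c) 0 N)) @ \oo
     --> Osum h p)%classic.
Proof.
move=> pl; rewrite OsumE.
apply: (cvgn_compsum (G := fun N c => nested_sum (add_exponents p c) 0 N)) => c sc.
exact/Lish_cvg/pl.
Qed.

End Limits.

(** * Passage to the limit in the truncated duality *)

Section Duality.
Variable R : realType.
Local Open Scope complex_scope.
Implicit Types p q : seq (R[i] * nat).

Lemma good_pair_cvg p : good_pair p -> exists l, tends (nested_sum p 0) l.
Proof.
move=> gp; case: p gp => [|c p] gp.
  by exists 1 => e e0; exists 0%N => n _; rewrite subrr normr0.
have [//|C C0 CP] := nested_sum_abs_bound _ gp.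
apply: (@complex_cvg_dominated R _ (fun N => nested_sum (abs_pair (c :: p)) 0 N) (C / 1%:R)).
  by move=> N; exact: nested_sum_step_le.
by move=> N; exact: CP.
Qed.

Lemma scale_harm_complex n : 4 * (1 + harm R[i] n) = (4 * (1 + harm R n))%:C.
Proof. by rewrite harm_complex rmorphM rmorph_nat rmorphD rmorph1. Qed.

Lemma Osum_duality p q h :
  is_index (unzip2 p) -> is_index (unzip2 q) -> word q = dual_word (word p) ->
  all (@good_letter R[i]) (word p) -> head None (word p) <> None ->
  contractive_last (word p) -> contractive_last (word q) ->
  Osum h p = (-1) ^+ pair_ne1 p *
    \sum_(0 <= i < h.+1) compsum i (pair_ne1 p) (fun b => Osum (h - i) (expand_pair q b)).
Proof.
move=> ip iq qE gw hw lp lq.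
have dE : pair_ne1 q = pair_ne1 p by rewrite !pair_ne1_word qE count_dual_word.
have bw : all (@bounded_letter R[i]) (word p).
  by apply: sub_all gw => -[z|] //= /orP[/eqP->|/andP[]//]; rewrite normr1.
have bq : all (@bounded_letter R[i]) (word q).
  rewrite qE all_rev all_map; apply: sub_all gw => -[z|] /=; last by rewrite normr1.
  by case: eqP => //= _ /andP[].
have gp := good_pair_word ip bw lp; have gq := good_pair_word iq bq lq.
pose u N := compsum h (size p) (fun c => nested_sum (add_exponents p c) 0 N).
pose v N := \sum_(0 <= i < h.+1) compsum i (pair_ne1 p) (fun b =>
  compsum (h - i)%N (size (expand_pair q b)) (fun e =>
    nested_sum (add_exponents (expand_pair q b) e) 0 N)).
apply: (@tends_unique_scaled R[i] u v).
- apply: Osum_cvg => c sc; apply: good_pair_cvg; exact: good_add_exponents.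
- apply: cvgn_sum => i _.
  apply: (cvgn_compsum (G := fun N b => compsum (h - i)%N (size (expand_pair q b)) (fun e =>
    nested_sum (add_exponents (expand_pair q b) e) 0 N))) => b _.
  apply: Osum_cvg => c sc; apply: good_pair_cvg; apply: good_add_exponents => //.
  exact: good_expand_pair.
(* The outermost letter comes first in [w]. *)
move=> e /complex_eps[r r0 ->]; pose w := rev (word p).
(* [t ^+ h] is lost in extracting the coefficient of degree [h], [t ^+ size w] in moving the
   letters. *)
pose J := (h + size w)%N.
have [n0 n0P] := @harm_pow_negligible R (24 * size w)%:R J r (ler0n _ _) r0.
exists n0 => N /n0P rN.
pose t : R[i] := 4 * (1 + harm R[i] (N + N)).
have t2 : 2 <= t.
  rewrite /t -[leLHS]mulr1; apply: ler_pM => //; rewrite ?ler_nat //.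
  by rewrite lerDl harm_ge0.
have t0 : 0 < t by apply: lt_le_trans t2.
have uE : u N = tcoef h (connected_sum (tpsX R[i] h) (tpsiv R[i] h) N
    (wordL (tpsiv R[i] h) w) (wordR (tpsiv R[i] h) [::])).
  rewrite connected_sum_deltar; last by move=> i i0; exact: tpsivP.
  rewrite [X in tcoef h X](sum_foldr_kernel_sum (kerL (tpsiv R[i] h)) p N).
  by rewrite tcoef_kernel_sum.
have vE : v N = tcoef h (connected_sum (tpsX R[i] h) (tpsiv R[i] h) N
    (wordL (tpsiv R[i] h) [::])
    (wordR (tpsiv R[i] h) (catrev (map (@dual_letter R[i]) w) [::]))).
  rewrite connected_sum_deltal; last by move=> i i0; exact: tpsivP.
  have -> : catrev (map (@dual_letter R[i]) w) [::] = rev (word q).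
    by rewrite /w qE /dual_word revK -/(rev _) map_rev revK.
  rewrite [X in tcoef h X](sum_foldr_kernel_sum (kerR (tpsiv R[i] h)) q N).
  by rewrite tcoef_kernel_sum_kerR // dE.
have sE : \prod_(l <- w) sgn_letter l = (-1) ^+ pair_ne1 p.
  by rewrite sgn_word /w count_rev -pair_ne1_word.
rewrite sub0r normrN uE vE -sE -tcoefZ -tcoefB.
apply: le_lt_trans (tcoef_le_tnorm t0 _ (leqnn h)) _.
have tX k : t ^+ k = ((4 * (1 + harm R (N + N))) ^+ k)%:C.
  by rewrite /t scale_harm_complex rmorphXn.
apply: (@le_lt_trans _ _ (t ^+ h * ((24 * size w)%:R * t ^+ (size w + 0) / N.+1%:R))).
  rewrite ler_pM2l ?exprn_gt0 //; apply: word_transport => //.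
  - by move=> i i0; exact: tpsivP.
  - by move=> a; exact: tnorm_ge0.
  - by move=> a b; exact: tnormD.
  - by move=> a b; exact: tnormM.
  - by move=> a b; exact: tnormZ.
  - exact: tnorm1.
  - by move=> i i0; exact: tnorm_sub.
  - by move=> i i0; exact: tnorm_iv.
  - by rewrite all_rev.
  - rewrite /w; case: (word p) hw => [|l s] //= hl.
    by rewrite rev_cons last_rcons; apply/eqP.
  (* The outermost letter is not [Some 1], since 1 is not in the open disc. *)
  - left; rewrite /w; case/lastP: (word p) lp => [|s l] //.
    rewrite /contractive_last last_rcons rev_rcons /=.
    by case: l => [z|] // z1; apply/eqP => -[z1']; move: z1; rewrite z1' normr1 ltxx.
rewrite addn0 mulrA mulrCA -exprD -/J tX -ltcR in rN *.
apply: le_lt_trans rN; rewrite le_eqVlt; apply/orP; left; apply/eqP.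
by rewrite rmorphM rmorphM fmorphV !rmorph_nat.
Qed.

(** [Re z <= 1 / 2] means that [z] is at least as close to 0 as to 1. *)
Lemma halfplane_norm_le (z : R[i]) : complex.Re z <= 1 / 2 -> `|z / (z - 1)| <= 1.
Proof.
case: z => a b /= ab.
have n0 : 0 < `|a +i* b - 1|.
  rewrite normr_gt0 subr_eq0; apply/eqP => -[a1 _]; move: ab; rewrite a1; lra.
rewrite normf_div ler_pdivrMr // mul1r !normc_def lecR /= ler_sqrt; last first.
  by rewrite addr_ge0 ?sqr_ge0.
by rewrite oppr0 addr0 lerD2r; nra.
Qed.

Lemma halfplane_norm_lt (z : R[i]) : complex.Re z < 1 / 2 -> `|z / (z - 1)| < 1.
Proof.
case: z => a b /= ab.
have n0 : 0 < `|a +i* b - 1|.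
  rewrite normr_gt0 subr_eq0; apply/eqP => -[a1 _]; move: ab; rewrite a1; lra.
rewrite normf_div ltr_pdivrMr // mul1r !normc_def ltcR /= ltr_sqrt.
  by rewrite oppr0 addr0 ltrD2r; nra.
by rewrite oppr0 addr0; nra.
Qed.

Lemma all_word (P : pred (option R[i])) z k : P None -> all (fun x => P (Some x)) z ->
  all P (word (zip z k)).
Proof.
move=> P0; elim: z k => [|x z IH] [|y k] //= /andP[Px Pz].
by rewrite Px all_cat all_nseq P0 orbT; exact: IH.
Qed.

Lemma contractive_last_word p :
  (~~ admissible (unzip2 p) -> `|last 1 (unzip1 p)| < 1) -> contractive_last (word p).
Proof.
case/lastP: p => // p [w k]; rewrite -cats1 /unzip1 /unzip2 !map_cat word_cat /=.
rewrite !cats1 admissible_rcons last_rcons /contractive_last last_cat /= cats0.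
case: k => [|[|k]] /= H; [exact: H | exact: H | by elim: k {H}].
Qed.

End Duality.

(** * Specialisation to pairs satisfying the dual condition *)

Theorem theorem6p10 (R : realType) (k : seq nat) (z : seq R[i])
    (k_index : is_index k) (k_nonempty : k <> [::])
    (size_z : size z = size k)
    (z_disc : forall x, x \in z -> `|x| <= 1)
    (dual_zk : dual_condition z k) :
  let d := num_ne1 z in
  (forall h : nat,
     Osum h (zip z k)
     = (-1) ^+ d *
       \sum_(i < h.+1)
         \sum_(b : d.-tuple 'I_i.+1
                 | (\sum_(j < d) val (tnth b j))%N == i)
           Osum (h - i) (expand_pair (dual_pair (zip z k)) [seq val x | x <- b]))
  /\ (d = 0%N ->
      admissible k /\
      forall h : nat, Osum h (ones R[i] k) = Osum h (ones R[i] (dual_index k))).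
Proof.
move=> d.
have wf := dual_condition_wf size_z k_index dual_zk.
have u1 : unzip1 (zip z k) = z by rewrite unzip1_zip ?size_z.
have u2 : unzip2 (zip z k) = k by rewrite unzip2_zip ?size_z.
have first h : Osum h (zip z k) = (-1) ^+ d *
    \sum_(0 <= i < h.+1) compsum i d
      (fun b => Osum (h - i) (expand_pair (dual_pair (zip z k)) b)).
  have -> : d = pair_ne1 (zip z k) by rewrite /pair_ne1 u1.
  have [cz hz lz] := dual_zk.
  have qE := word_dual_pair wf.
  have gw : all (@good_letter R[i]) (word (zip z k)).
    have : all (fun x => good_letter (Some x)) z.
      apply/allP => x /cz[[x1 _ xRe]|->] /=; last by rewrite eqxx.
      by rewrite x1 halfplane_norm_le ?orbT.
    exact: all_word.
  (* A modulus at most 1 and different from 1 is less than 1. *)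
  have lw : contractive_last (word (zip z k)).
    apply: contractive_last_word; rewrite u1 u2 => /lz l1.
    rewrite lt_neqAle l1; case/lastP: (z) z_disc => [|s x] zd; first by rewrite normr1 lexx.
    by rewrite last_rcons zd // mem_rcons mem_head.
  have [x [s xs]] : exists x s, word (zip z k) = Some x :: s /\ x = head 1 z /\ x \in z.
    case: z {d wf u1 u2 cz hz lz qE gw lw dual_zk z_disc} size_z => [|x z'].
      by case: k {k_index} k_nonempty.
    case: k {k_index} k_nonempty => // y k' _ _.
    by exists x; eexists; split; [reflexivity | rewrite mem_head].
  have [ws [xh xz]] := xs.
  apply: Osum_duality => //; rewrite ?u2 //; first exact: is_index_dual_pair.
    by rewrite ws.
  (* The dual word ends with the dual of the letter of [z_1]; [Re z_1 <> 1 / 2] makes the half-plane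
     inequality strict, which gives convergence on the dual side. *)
  rewrite qE ws /contractive_last /dual_word /= rev_cons last_rcons.
  have [//|x1 /=] := eqVneq x 1; apply: halfplane_norm_lt.
  rewrite lt_neqAle xh hz -xh; have [[_ _ ->//]|x1'] := cz _ xz.
  by rewrite x1' eqxx in x1.
split=> [h|d0].
  rewrite first big_mkord; congr (_ * _); apply: eq_bigr => i _.
  by rewrite -(@sum_tuple_compsum _ d i.+1).
have z1 : z = nseq (size k) 1.
  rewrite -size_z; apply/all_pred1P; rewrite all_count -(count_predC (pred1 1) z).
  by rewrite [count (predC _) z]d0 addn0.
have zk : zip z k = ones R[i] k.
  by rewrite z1; elim: (k) => //= y k' ->.
split.
  have [_ _ lz] := dual_zk; apply/negPn/negP => /lz; rewrite z1.
  have -> : last 1 (nseq (size k) 1) = 1 :> R[i] by elim: (size k).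
  by rewrite normr1 eqxx.
move=> h; have := first h; rewrite d0 zk mul1r => ->.
(* With [d = 0] the only composition is the empty one, so only [i = 0] contributes. *)
rewrite big_nat_recl //= big1 ?addr0 ?subn0 //.
rewrite /dual_pair /decompose -[ones R[i] k]cats0 decompose_from_ones /=.
by rewrite /dual_assemble /= cats0 expand_pair_ones.
Qed.
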